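(* Let $\zeta\in X^1(\mathbb Z)$. For any $p\ge1$, the modified gDNLS equation $$i\frac{d\Phi_n}{dt}+\kappa(\Delta(\Phi+\zeta))_n+\gamma\big[F(|\Phi_n+\zeta_n|^2)-F(q_0^2)\big](\Phi_n+\zeta_n)=0,\quad n\in\mathbb Z,$$ with initial condition $\Phi(0)=(\Phi_n(0))_{n\in\mathbb Z}\in\ell^2$ and zero boundary conditions at infinity, $\lim_{|n|\to\infty}\Phi_n(t)=0$, $t\ge0$, possesses a unique solution $\Phi\in\overline{B(0,\rho)}\subset C([0,T];\ell^2)$, where $B(0,\rho)$ denotes the open ball centered at the origin with radius $$\rho=\rho(T)=2\Big[\|\Phi(0)\|_{\ell^2}+\sqrt{2\kappa}\,\|\zeta'\|_{\ell^2}\sqrt T+2^{2p+\frac32}|\gamma|K\big(\|\zeta\|_{\ell^\infty}+\||\zeta|-q_0\|_{\ell^2}+q_0\big)^{2p+1}T\Big],$$ and the lifespan $T>0$ satisfies $$2^{2p+\frac52}|\gamma|K\big(\rho(T)+\|\zeta\|_{\ell^\infty}+q_0\big)^{2p}\,T\le1.$$ Furthermore, the solution depends continuously on the initial data.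
   Context: $\ell^r=\ell^r(\mathbb Z)$ are spaces of complex sequences; $(\Delta u)_n:=u_{n+1}+u_{n-1}-2u_n$; $\kappa>0$, $\gamma\in\mathbb R$; $\zeta'_n:=\zeta_n-\zeta_{n-1}$; $X^1(\mathbb Z):=\{\zeta\in\ell^\infty:\zeta'\in\ell^2\}$; $|\zeta|-q_0$ denotes the sequence $(|\zeta_n|-q_0)_{n\in\mathbb Z}$. The background satisfies $\lim_{n\to\pm\infty}\zeta_n=\zeta_\pm\in\mathbb C$ with $|\zeta_\pm|=q_0>0$. $C([0,T];\ell^2)$ carries the norm $\sup_{t\in[0,T]}\|\cdot\|_{\ell^2}$. The function $F:\mathbb R\to\mathbb R$ satisfies $F(0)=0$, $|F(x)-F(y)|\le K(|x|^{p-1}+|y|^{p-1})|x-y|$ and $|F'(x)|\le K|x|^{p-1}$ for a constant $K>0$ and all $x,y\ge0$. The equation arises from $i\frac{dU_n}{dt}+\kappa(\Delta U)_n+\gamma F(|U_n|^2)U_n=0$ through $U_n(t)=e^{i\gamma F(q_0^2)t}(\Phi_n(t)+\zeta_n)$, so that $\Phi_n(0)=U_n(0)-\zeta_n$. A solution is understood as a solution of the corresponding time-integrated (Duhamel) equation. *)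

(* Defs.v *)
From Stdlib Require Import Reals ZArith.
From Coquelicot Require Import Coquelicot.

Open Scope R_scope.

(* In the standard library [Rpower 0 a = 1] for every a; this version has
   0^0 = 1 and 0^a = 0 otherwise, which is what |x|^(p-1) needs at x = 0. *)
Definition rpow (x a : R) : R :=
  if Req_EM_T x 0 then (if Req_EM_T a 0 then 1 else 0) else Rpower x a.

Definition seqZ := Z -> C.

Definition seq_sub (u v : seqZ) : seqZ := fun n => (u n - v n)%C.

(* The k-th term groups the indices k and -(k+1), so that every integer
   is met exactly once as k ranges over nat. *)
Definition sq_term (u : seqZ) (k : nat) : R :=
  (Cmod (u (Z.of_nat k)))^2 + (Cmod (u (- Z.of_nat (S k))%Z))^2.

Definition ell2 (u : seqZ) : Prop := ex_series (sq_term u).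

(* Meaningful only under [ell2 u]. *)
Definition norm2 (u : seqZ) : R := sqrt (Series (sq_term u)).

Definition ellinf (u : seqZ) : Prop := exists M, forall n, Cmod (u n) <= M.

(* Meaningful only under [ellinf u]. *)
Definition norminf (u : seqZ) : R :=
  real (Lub_Rbar (fun x => exists n, x = Cmod (u n))).

Definition lim_pinf (u : seqZ) (l : C) : Prop :=
  filterlim (fun k : nat => u (Z.of_nat k)) eventually (locally l).

Definition lim_minf (u : seqZ) (l : C) : Prop :=
  filterlim (fun k : nat => u (- Z.of_nat k)%Z) eventually (locally l).

Definition lap (u : seqZ) : seqZ :=
  fun n => (u (n + 1)%Z + u (n - 1)%Z - 2 * u n)%C.

Definition bdiff (u : seqZ) : seqZ := fun n => (u n - u (n - 1)%Z)%C.

Definition X1 (zeta : seqZ) : Prop := ellinf zeta /\ ell2 (bdiff zeta).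

(* |zeta| - q0 *)
Definition mod_defect (q0 : R) (zeta : seqZ) : seqZ :=
  fun n => RtoC (Cmod (zeta n) - q0).

Definition F_hyp (F : R -> R) (K p : R) : Prop :=
  F 0 = 0 /\
  (forall x y, 0 <= x -> 0 <= y ->
     Rabs (F x - F y)
     <= K * (rpow (Rabs x) (p - 1) + rpow (Rabs y) (p - 1)) * Rabs (x - y)) /\
  (forall x, 0 <= x ->
     ex_derive F x /\ Rabs (Derive F x) <= K * rpow (Rabs x) (p - 1)).

Definition CSeries (a : nat -> C) : C :=
  (Series (fun k => fst (a k)), Series (fun k => snd (a k))).

(* The group exp(i kappa t Delta): exponential series of the bounded operator
   i kappa t Delta, evaluated at index n. *)
Definition propag (kappa t : R) (u : seqZ) : seqZ :=
  fun n => CSeries (fun k =>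
    ((Ci * RtoC (kappa * t)) ^ k / RtoC (INR (fact k)) * Nat.iter k lap u n)%C).

Definition nonlin (F : R -> R) (q0 : R) (zeta phi : seqZ) : seqZ :=
  fun n => (RtoC (F ((Cmod (phi n + zeta n)%C)^2) - F (q0^2))%R
            * (phi n + zeta n))%C.

(* Writing the equation as i Phi' + kappa Delta Phi = - forcing. *)
Definition forcing (kappa gamma : R) (F : R -> R) (q0 : R) (zeta phi : seqZ)
  : seqZ :=
  fun n => (RtoC kappa * lap zeta n + RtoC gamma * nonlin F q0 zeta phi n)%C.

Definition CT_ell2 (T : R) (Phi : R -> seqZ) : Prop :=
  (forall t, 0 <= t <= T -> ell2 (Phi t)) /\
  (forall t, 0 <= t <= T ->
     filterlim (fun s => norm2 (seq_sub (Phi s) (Phi t)))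
       (within (fun s => 0 <= s <= T) (locally t)) (locally 0)).

Definition normCT (T : R) (Phi : R -> seqZ) : Rbar :=
  Lub_Rbar (fun x => exists t, 0 <= t <= T /\ x = norm2 (Phi t)).

Definition in_closed_ball (T r : R) (Phi : R -> seqZ) : Prop :=
  CT_ell2 T Phi /\ Rbar_le (normCT T Phi) (Finite r).

Definition duhamel (kappa gamma : R) (F : R -> R) (q0 : R) (zeta : seqZ)
    (T : R) (Phi0 : seqZ) (Phi : R -> seqZ) : Prop :=
  forall t, 0 <= t <= T -> forall n : Z,
    let g := fun s => propag kappa (t - s) (forcing kappa gamma F q0 zeta (Phi s)) n in
    @ex_RInt C_R_NormedModule g 0 t /\
    Phi t n = (propag kappa t Phi0 n
               + Ci * @RInt C_R_CompleteNormedModule g 0 t)%C.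

Definition solution (kappa gamma : R) (F : R -> R) (q0 : R) (zeta : seqZ)
    (T : R) (Phi0 : seqZ) (Phi : R -> seqZ) : Prop :=
  CT_ell2 T Phi /\
  duhamel kappa gamma F q0 zeta T Phi0 Phi /\
  (forall n, Phi 0 n = Phi0 n) /\
  (forall t, 0 <= t <= T ->
     lim_pinf (Phi t) (RtoC 0) /\ lim_minf (Phi t) (RtoC 0)).

Definition rho (kappa gamma K p q0 : R) (zeta Phi0 : seqZ) (T : R) : R :=
  2 * (norm2 Phi0
       + sqrt (2 * kappa) * norm2 (bdiff zeta) * sqrt T
       + Rpower 2 (2 * p + 3 / 2) * Rabs gamma * K
         * Rpower (norminf zeta + norm2 (mod_defect q0 zeta) + q0) (2 * p + 1)
         * T).

Definition lifespan_cond (kappa gamma K p q0 : R) (zeta Phi0 : seqZ) (T : R)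
  : Prop :=
  Rpower 2 (2 * p + 5 / 2) * Rabs gamma * K
  * Rpower (rho kappa gamma K p q0 zeta Phi0 T + norminf zeta + q0) (2 * p)
  * T <= 1.

Definition solution_in_ball (kappa gamma K p : R) (F : R -> R) (q0 : R)
    (zeta : seqZ) (T : R) (Phi0 : seqZ) (Phi : R -> seqZ) : Prop :=
  solution kappa gamma F q0 zeta T Phi0 Phi /\
  in_closed_ball T (rho kappa gamma K p q0 zeta Phi0 T) Phi.

(* Main.v *)
(* The group [exp (i kappa t Delta)] is handled coordinatewise: its power series has
   infinite radius of convergence, so every coordinate solves [u' = i kappa lap u].
   The quantity [|exp (i kappa t Delta) u - z|^2] grows at rate
   [2 kappa Re <i exp (i kappa t Delta) u', z'>], with primes for backward differences.
   For [z = 0] this shows that the group is a contraction of l2; for [z = u = zeta] it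
   gives [|exp (i kappa t Delta) zeta - zeta| <= sqrt (2 kappa t) |zeta'|], and the
   left-hand side is the Duhamel integral of the linear forcing [kappa Delta zeta].
   With [S = rho + |zeta|_inf + q0], the nonlinearity is bounded on the rho-ball by
   [2 K S^(2p) (rho + ||zeta| - q0|)] and has Lipschitz constant [6 K S^(2p)], while the
   lifespan condition forces [|gamma| K S^(2p) T <= 1/16].  Hence the Duhamel map sends
   the closed rho-ball to itself and contracts by 1/2. *)

Require Import Defs.
From Stdlib Require Import Reals ZArith Lra Lia FunctionalExtensionality.
From Coquelicot Require Import Coquelicot.

(** * Partial sums and the l2 norm *)

(** The background is not in l2, so its estimates may use only its sup bound and its differences.
    Hence the group is studied as a scalar power series in each coordinate, and l2 bounds are bounds
    on finite windows of indices, uniform in the window, got by testing a sequence against itself.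
    Scalar calculus then replaces l2-valued integrals and the completeness of C([0,T]; l2).
    Estimating kappa Delta zeta in l2 under the Duhamel integral would cost a multiple of T;
    integrating it exactly gives the sqrt T that [rho] prescribes. The defect d = | |zeta| - q0 |_2
    may exceed the radius, so closing the ball needs a case distinction: a small defect is absorbed
    by the factor 2 in [rho], a large one is paid for by the last term of [rho]. For continuous
    dependence the obstacle is that the radius depends on the data: a perturbed solution may lie in
    a larger ball. The lifespan condition leaves room for this: the contraction constant worsens to
    3/4, which yields the stability factor 1 / (1 - 3/4) = 4. *)

Definition dot (z w : C) : R := fst z * fst w + snd z * snd w.

(** The real inner product Re <u, v> on the window -(N+1), ..., N, with the index pairing of
    [sq_term]. Taking the real part makes [i u] orthogonal to [u]. *)
Definition psum (N : nat) (u v : seqZ) : R :=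
  sum_f_R0 (fun k => dot (u (Z.of_nat k)) (v (Z.of_nat k))
    + dot (u (- Z.of_nat (S k))%Z) (v (- Z.of_nat (S k))%Z)) N.

Definition sq_le (u : seqZ) (S : R) : Prop := forall N, psum N u u <= S.

(** Membership and size in one predicate, free of convergence questions. The sign of [M] is recorded
    because [M ^ 2] forgets it. *)
Definition l2_le (u : seqZ) (M : R) : Prop := 0 <= M /\ sq_le u (M ^ 2).

Definition seq_add (u v : seqZ) : seqZ := fun n => (u n + v n)%C.
Definition seq_scal (c : C) (u : seqZ) : seqZ := fun n => (c * u n)%C.

Lemma dot_Cmod z : dot z z = Cmod z ^ 2.
Proof. unfold dot, Cmod. rewrite pow2_sqrt; nra. Qed.

Lemma dot_le_Cmod z w : Rabs (dot z w) <= Cmod z * Cmod w.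
Proof.
  pose proof (Cmod_ge_0 z). pose proof (Cmod_ge_0 w).
  apply Rsqr_incr_0_var; [|nra].
  rewrite <- Rsqr_abs. unfold Rsqr.
  replace (Cmod z * Cmod w * (Cmod z * Cmod w)) with (Cmod z ^ 2 * Cmod w ^ 2) by ring.
  rewrite <- !dot_Cmod. unfold dot.
  pose proof (pow2_ge_0 (fst z * snd w - snd z * fst w)). nra.
Qed.

Lemma dot_nonneg z : 0 <= dot z z.
Proof. unfold dot; nra. Qed.

Lemma psum_nonneg N u : 0 <= psum N u u.
Proof.
  apply cond_pos_sum; intros k.
  pose proof (dot_nonneg (u (Z.of_nat k))).
  pose proof (dot_nonneg (u (- Z.of_nat (S k))%Z)). lra.
Qed.

Lemma psum_mono N M u : (N <= M)%nat -> psum N u u <= psum M u u.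
Proof.
  induction 1 as [|M _ IH]; [lra|].
  unfold psum in *; rewrite tech5.
  pose proof (dot_nonneg (u (Z.of_nat (S M)))).
  pose proof (dot_nonneg (u (- Z.of_nat (S (S M)))%Z)). lra.
Qed.

Lemma psum_sym N u v : psum N u v = psum N v u.
Proof. apply sum_eq; intros; unfold dot; ring. Qed.

Lemma psum_lin_r N u v w (a b : R) (x : seqZ) :
  (forall n, x n = (RtoC a * v n + RtoC b * w n)%C) ->
  psum N u x = a * psum N u v + b * psum N u w.
Proof.
  intros H. unfold psum.
  rewrite !scal_sum, <- sum_plus. apply sum_eq; intros k _.
  rewrite !H. unfold dot; simpl; ring.
Qed.

Lemma psum_lin_sq N v w (a b : R) (x : seqZ) :
  (forall n, x n = (RtoC a * v n + RtoC b * w n)%C) ->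
  psum N x x = a ^ 2 * psum N v v + 2 * a * b * psum N v w + b ^ 2 * psum N w w.
Proof.
  intros H.
  rewrite (psum_lin_r N x v w a b x H), (psum_sym N x v), (psum_sym N x w).
  rewrite (psum_lin_r N v v w a b x H), (psum_lin_r N w v w a b x H).
  rewrite (psum_sym N w v). ring.
Qed.

Lemma psum_CS N u v A B :
  0 <= A -> 0 <= B -> psum N u u <= A ^ 2 -> psum N v v <= B ^ 2 ->
  psum N u v <= A * B.
Proof.
  intros HA HB Hu Hv.
  (* Expanding |B u - A v|^2 >= 0 bounds the cross term after division by [A * B]; the case of a
     vanishing bound is left to [Hz]. *)
  pose proof (psum_lin_sq N u v B (- A) _ (fun n => eq_refl)) as H1.
  match type of H1 with psum _ ?x _ = _ => pose proof (psum_nonneg N x) as H2 end.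
  assert (Hp : 2 * (A * B) * psum N u v <= 2 * (A * B) * (A * B)).
  { pose proof (psum_nonneg N u). pose proof (psum_nonneg N v).
    pose proof (pow2_ge_0 A). pose proof (pow2_ge_0 B). nra. }
  (* Stretching the null factor [s] in |l s - t|^2 >= 0 gives <s, t> <= C'^2 / (2 l), which is below
     [e] for the chosen [l]. *)
  assert (Hz : forall s t C', psum N s s <= 0 -> 0 <= C' -> psum N t t <= C' ^ 2 ->
    psum N s t <= 0).
  { intros s t C' Hs HC Ht. apply le_epsilon; intros e He. rewrite Rplus_0_l.
    set (l := (C' ^ 2 + 1) / e).
    assert (Hl : 0 < l) by (apply Rdiv_lt_0_compat; nra).
    pose proof (psum_lin_sq N s t l (- 1) _ (fun n => eq_refl)) as H3.
    match type of H3 with psum _ ?x _ = _ => pose proof (psum_nonneg N x) as H4 end.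
    assert (He' : l * e = C' ^ 2 + 1) by (unfold l; field; lra).
    pose proof (pow2_ge_0 l). nra. }
  destruct (Req_dec A 0) as [->|]; [|destruct (Req_dec B 0) as [->|]].
  - rewrite Rmult_0_l. apply (Hz u v B); auto. simpl in Hu; lra.
  - rewrite Rmult_0_r, psum_sym. apply (Hz v u A); auto. simpl in Hv; lra.
  - assert (0 < A * B) by (apply Rmult_lt_0_compat; lra). nra.
Qed.

Lemma psum_le_sq N u A : 0 <= A -> psum N u u <= sqrt (psum N u u) * A ->
  psum N u u <= A ^ 2.
Proof.
  intros HA H. pose proof (psum_nonneg N u) as H0.
  pose proof (sqrt_pos (psum N u u)) as H1.
  pose proof (pow2_sqrt _ H0) as H2. rewrite <- H2.
  apply pow_incr; split; auto.
  destruct (Rle_lt_dec (sqrt (psum N u u)) A) as [|Hlt]; auto. nra.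
Qed.

Lemma l2_le_ext u v M : (forall n, u n = v n) -> l2_le u M -> l2_le v M.
Proof. intros H. replace v with u; auto. apply functional_extensionality; auto. Qed.

Lemma l2_le_weaken u M M' : M <= M' -> l2_le u M -> l2_le u M'.
Proof.
  intros H [H0 H1]; split; [lra|]. intros N; pose proof (H1 N).
  assert (M ^ 2 <= M' ^ 2) by (apply pow_incr; lra). lra.
Qed.

Lemma l2_le_add u v A B : l2_le u A -> l2_le v B -> l2_le (seq_add u v) (A + B).
Proof.
  intros [HA Hu] [HB Hv]; split; [lra|]. intros N.
  rewrite (psum_lin_sq N u v 1 1).
  - pose proof (psum_CS N u v A B HA HB (Hu N) (Hv N)).
    specialize (Hu N); specialize (Hv N). nra.
  - intros n; unfold seq_add; ring.
Qed.

Lemma l2_le_dom u v M : 0 <= M ->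
  (forall n, Cmod (u n) <= Cmod (v n)) -> l2_le v M -> l2_le u M.
Proof.
  intros HM H [_ Hv]; split; auto. intros N; eapply Rle_trans; [|apply (Hv N)].
  apply sum_Rle; intros k _. rewrite !dot_Cmod.
  apply Rplus_le_compat; apply pow_incr; split; auto using Cmod_ge_0.
Qed.

Lemma l2_le_scal c u M : l2_le u M -> l2_le (seq_scal c u) (Cmod c * M).
Proof.
  intros [HM Hu]; split; [pose proof (Cmod_ge_0 c); nra|]. intros N.
  replace (psum N (seq_scal c u) (seq_scal c u)) with (Cmod c ^ 2 * psum N u u).
  - rewrite Rpow_mult_distr. apply Rmult_le_compat_l; auto using pow2_ge_0.
  - unfold psum. rewrite scal_sum. apply sum_eq; intros k _.
    rewrite !dot_Cmod. unfold seq_scal. rewrite !Cmod_mult. ring.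
Qed.

Lemma l2_le_sub u v A B : l2_le u A -> l2_le v B -> l2_le (seq_sub u v) (A + B).
Proof.
  intros Hu Hv. apply l2_le_ext with (seq_add u (seq_scal (- RtoC 1)%C v)).
  - intros n. unfold seq_add, seq_scal, seq_sub. ring.
  - apply l2_le_add; auto. replace B with (Cmod (- RtoC 1)%C * B).
    + apply l2_le_scal; auto.
    + rewrite Cmod_opp, Cmod_1; ring.
Qed.

Lemma l2_le_dom_add c u v w A B : 0 <= c ->
  (forall n, Cmod (u n) <= c * (Cmod (v n) + Cmod (w n))) ->
  l2_le v A -> l2_le w B -> l2_le u (c * (A + B)).
Proof.
  intros Hc H Hv Hw.
  assert (Hmod : forall x M, l2_le x M -> l2_le (fun n => RtoC (Cmod (x n))) M).
  { intros x M Hx. apply l2_le_dom with x; auto. apply Hx.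
    intros n; rewrite Cmod_R, Rabs_pos_eq; [lra|apply Cmod_ge_0]. }
  apply l2_le_dom with (seq_scal (RtoC c)
    (seq_add (fun n => RtoC (Cmod (v n))) (fun n => RtoC (Cmod (w n))))).
  - pose proof (proj1 Hv). pose proof (proj1 Hw). nra.
  - intros n. unfold seq_scal, seq_add.
    rewrite <- RtoC_plus, <- RtoC_mult, Cmod_R. eapply Rle_trans; [apply H|apply Rle_abs].
  - replace c with (Cmod (RtoC c)) at 2 by (rewrite Cmod_R, Rabs_pos_eq; auto).
    apply l2_le_scal, l2_le_add; apply Hmod; auto.
Qed.

Lemma l2_le_zero : l2_le (fun _ => RtoC 0) 0.
Proof.
  split; [lra|]. intros N. unfold psum.
  rewrite (sum_eq _ (fun _ => 0)), sum_cte; [lra|]. intros; unfold dot; simpl; ring.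
Qed.

Lemma Z_index n : (exists k, n = Z.of_nat k) \/ (exists k, n = (- Z.of_nat (S k))%Z).
Proof.
  destruct (Z_le_gt_dec 0 n); [left; exists (Z.to_nat n)|right; exists (Z.to_nat (- n - 1))]; lia.
Qed.

Lemma l2_le_Cmod u M n : l2_le u M -> Cmod (u n) <= M.
Proof.
  intros [HM Hu].
  apply Rsqr_incr_0_var; auto. rewrite !Rsqr_pow2, <- dot_Cmod.
  assert (Hk : forall k, dot (u (Z.of_nat k)) (u (Z.of_nat k))
    + dot (u (- Z.of_nat (S k))%Z) (u (- Z.of_nat (S k))%Z) <= M ^ 2).
  { intros k. eapply Rle_trans; [|apply (Hu k)]. unfold psum. destruct k.
    - simpl; lra.
    - rewrite tech5. pose proof (psum_nonneg k u). unfold psum in *; lra. }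
  destruct (Z_index n) as [[k ->]|[k ->]]; specialize (Hk k).
  - pose proof (dot_nonneg (u (- Z.of_nat (S k))%Z)); lra.
  - pose proof (dot_nonneg (u (Z.of_nat k))); lra.
Qed.

(** The window -(N+1), ..., N moves to -N, ..., N+1: one index enters on the right and one leaves on
    the left. *)
Lemma psum_shift N u v :
  psum N (fun n => u (n + 1)%Z) (fun n => v (n + 1)%Z)
  = psum N u v + dot (u (Z.of_nat (S N))) (v (Z.of_nat (S N)))
    - dot (u (- Z.of_nat (S N))%Z) (v (- Z.of_nat (S N))%Z).
Proof.
  induction N as [|N IH].
  - unfold psum; simpl. ring.
  - unfold psum in *. rewrite !tech5, IH.
    replace (Z.of_nat (S N) + 1)%Z with (Z.of_nat (S (S N))) by lia.
    replace (- Z.of_nat (S (S N)) + 1)%Z with (- Z.of_nat (S N))%Z by lia. ring.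
Qed.

Lemma l2_le_shift_succ u M : l2_le u M -> l2_le (fun n => u (n + 1)%Z) M.
Proof.
  intros [HM Hu]; split; auto. intros N. rewrite psum_shift.
  specialize (Hu (S N)). unfold psum in Hu; rewrite tech5 in Hu. fold (psum N u u) in Hu.
  pose proof (dot_nonneg (u (- Z.of_nat (S N))%Z)).
  pose proof (dot_nonneg (u (- Z.of_nat (S (S N)))%Z)). lra.
Qed.

(** The reflection n -> -1 - n swaps the two members of each pair k, -(k+1), so every partial sum is
    unchanged. It conjugates one shift into the other. *)
Lemma l2_le_reflect u M : l2_le u M -> l2_le (fun n => u (- 1 - n)%Z) M.
Proof.
  intros [HM Hu]; split; auto. intros N. eapply Rle_trans; [|apply (Hu N)].
  apply Req_le, sum_eq; intros k _. rewrite Rplus_comm.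
  replace (- 1 - Z.of_nat k)%Z with (- Z.of_nat (S k))%Z by lia.
  replace (- 1 - - Z.of_nat (S k))%Z with (Z.of_nat k) by lia. reflexivity.
Qed.

Lemma l2_le_shift_pred u M : l2_le u M -> l2_le (fun n => u (n - 1)%Z) M.
Proof.
  intros H. apply l2_le_reflect, l2_le_shift_succ, l2_le_reflect in H.
  eapply l2_le_ext, H. intros n; cbv beta. f_equal. lia.
Qed.

Lemma l2_le_bdiff u M : l2_le u M -> l2_le (bdiff u) (2 * M).
Proof.
  intros H. replace (2 * M) with (M + M) by ring.
  apply (l2_le_sub u (fun n => u (n - 1)%Z)); auto using l2_le_shift_pred.
Qed.

Lemma lap_bdiff u n : lap u n = (bdiff u (n + 1)%Z - bdiff u n)%C.
Proof. unfold lap, bdiff. replace (n + 1 - 1)%Z with n by lia. ring. Qed.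

Lemma l2_le_lap_bdiff u M : l2_le (bdiff u) M -> l2_le (lap u) (2 * M).
Proof.
  intros H. apply l2_le_ext with (seq_sub (fun n => bdiff u (n + 1)%Z) (bdiff u)).
  - intros n. rewrite lap_bdiff. reflexivity.
  - replace (2 * M) with (M + M) by ring. apply l2_le_sub; auto.
    apply (l2_le_shift_succ (bdiff u)); auto.
Qed.

Lemma l2_le_lap u M : l2_le u M -> l2_le (lap u) (4 * M).
Proof.
  intros H. replace (4 * M) with (2 * (2 * M)) by ring.
  apply l2_le_lap_bdiff, l2_le_bdiff, H.
Qed.

(** * Window bounds versus [ell2] and [norm2]; pointwise limits *)

Lemma sq_term_psum N u : sum_n (sq_term u) N = psum N u u.
Proof. rewrite sum_n_Reals. apply sum_eq; intros. unfold sq_term. rewrite <- !dot_Cmod. reflexivity. Qed.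

Lemma l2_le_ell2 u M : l2_le u M -> ell2 u /\ norm2 u <= M.
Proof.
  intros [HM Hu].
  assert (Hmono : forall n, sum_n (sq_term u) n <= sum_n (sq_term u) (S n)).
  { intros n. rewrite !sq_term_psum. apply psum_mono; lia. }
  assert (Hb : forall n, sum_n (sq_term u) n <= M ^ 2).
  { intros n. rewrite sq_term_psum. apply Hu. }
  destruct (ex_finite_lim_seq_incr _ _ Hmono Hb) as [l Hl].
  split; [exists l; exact Hl|].
  unfold norm2. rewrite <- (sqrt_pow2 M HM). apply sqrt_le_1_alt.
  rewrite (is_series_unique _ l Hl).
  apply (is_lim_seq_le _ (fun _ => M ^ 2) l (M ^ 2) Hb Hl). apply is_lim_seq_const.
Qed.

Lemma l2_le_norm2 u : ell2 u -> l2_le u (norm2 u).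
Proof.
  intros H. split; [apply sqrt_pos|]. intros N.
  assert (Hs : psum N u u <= Series (sq_term u)).
  { rewrite <- sq_term_psum.
    apply (is_lim_seq_incr_compare (sum_n (sq_term u))).
    - apply Series_correct, H.
    - intros n. rewrite !sq_term_psum. apply psum_mono; lia. }
  unfold norm2. rewrite pow2_sqrt; auto.
  eapply Rle_trans; [apply (psum_nonneg N u)|auto].
Qed.

Lemma l2_le_zero_Cmod u M : l2_le u M -> forall e, 0 < e -> exists N, forall k, (N <= k)%nat ->
  Cmod (u (Z.of_nat k)) < e /\ Cmod (u (- Z.of_nat (S k))%Z) < e.
Proof.
  intros Hu e He. destruct (l2_le_ell2 _ _ Hu) as [H _].
  pose proof (ex_series_lim_0 _ H) as Hl. apply is_lim_seq_spec in Hl.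
  assert (He2 : 0 < e ^ 2) by (apply pow_lt; auto).
  destruct (Hl (mkposreal _ He2)) as [N HN]. exists N; intros k Hk.
  specialize (HN k Hk). simpl pos in HN. rewrite Rminus_0_r in HN.
  apply Rabs_lt_between in HN. destruct HN as [_ HN]. unfold sq_term in HN.
  pose proof (pow2_ge_0 (Cmod (u (Z.of_nat k)))).
  pose proof (pow2_ge_0 (Cmod (u (- Z.of_nat (S k))%Z))).
  split; apply Rsqr_incrst_0; rewrite ?Rsqr_pow2; auto using Cmod_ge_0; lra.
Qed.

Lemma sum_f_R0_lim (f : nat -> nat -> R) (g : nat -> R) N :
  (forall k, is_lim_seq (fun j => f j k) (g k)) ->
  is_lim_seq (fun j => sum_f_R0 (f j) N) (sum_f_R0 g N).
Proof.
  intros H. induction N as [|N IH]; simpl; auto.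
  apply is_lim_seq_plus'; auto.
Qed.

Definition ptlim (v : nat -> seqZ) (u : seqZ) : Prop := forall n,
  is_lim_seq (fun j => fst (v j n)) (fst (u n)) /\
  is_lim_seq (fun j => snd (v j n)) (snd (u n)).

(** Fatou's lemma in l2: on a fixed window only finitely many coordinates pass to the limit. The
    index [K] admits bounds that hold only eventually. *)
Lemma l2_le_ptlim v u M (K : nat) : ptlim v u ->
  (forall j, (K <= j)%nat -> l2_le (v j) M) -> l2_le u M.
Proof.
  intros H Hv. split; [apply (Hv K); lia|]. intros N.
  assert (Hl : is_lim_seq (fun j => psum N (v j) (v j)) (psum N u u)).
  { apply sum_f_R0_lim. intros k. unfold dot.
    repeat apply is_lim_seq_plus'; apply is_lim_seq_mult'; apply H. }
  assert (Hle : Rbar_le (psum N u u) (M ^ 2)); [|exact Hle].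
  apply (is_lim_seq_le_loc (fun j => psum N (v j) (v j)) (fun _ => M ^ 2)); auto.
  - exists K; intros j Hj. apply Hv; auto.
  - apply is_lim_seq_const.
Qed.

(** * Mean value and integral inequalities in l2 *)

(** Duality: with [A] the norm of [u] on the window, |u|^2 <= A M can be divided by [A]. A vector
    inequality thus reduces to scalar ones for the pairing with [u] itself. *)
Lemma l2_le_of_psum u M : 0 <= M ->
  (forall N A, 0 <= A -> psum N u u = A ^ 2 -> psum N u u <= A * M) -> l2_le u M.
Proof.
  intros HM H. split; auto. intros N. pose proof (psum_nonneg N u) as H0.
  apply psum_le_sq; auto. apply H; [apply sqrt_pos|]. rewrite pow2_sqrt; auto.
Qed.

Definition is_Cderive (f : R -> C) (t : R) (l : C) : Prop :=
  is_derive (fun s => fst (f s)) t (fst l) /\ is_derive (fun s => snd (f s)) t (snd l).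

Lemma psum_is_derive N u (f : R -> seqZ) t g :
  (forall n, is_Cderive (fun s => f s n) t (g n)) ->
  is_derive (fun s => psum N u (f s)) t (psum N u g).
Proof.
  intros H.
  assert (Hd : forall n, is_derive (fun s => dot (u n) (f s n)) t (dot (u n) (g n))).
  { intros n. destruct (H n) as [H1 H2]. unfold dot.
    apply (is_derive_plus (V := R_NormedModule)).
    - apply (is_derive_scal (fun s => fst (f s n))), H1.
    - apply (is_derive_scal (fun s => snd (f s n))), H2. }
  unfold psum. induction N as [|N IH].
  - simpl. apply (is_derive_plus (V := R_NormedModule)); apply Hd.
  - apply (is_derive_ext (fun s => sum_f_R0 (fun k => dot (u (Z.of_nat k)) (f s (Z.of_nat k))
      + dot (u (- Z.of_nat (S k))%Z) (f s (- Z.of_nat (S k))%Z)) N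
      + (dot (u (Z.of_nat (S N))) (f s (Z.of_nat (S N)))
      + dot (u (- Z.of_nat (S (S N)))%Z) (f s (- Z.of_nat (S (S N)))%Z)))).
    + intros s; reflexivity.
    + rewrite tech5. apply (is_derive_plus (V := R_NormedModule)); auto.
      apply (is_derive_plus (V := R_NormedModule)); apply Hd.
Qed.

(** The scalar mean value theorem is applied to the pairing with the fixed vector [f b - f a], so
    derivatives are needed only coordinate by coordinate. *)
Lemma l2_le_mean_value (f g : R -> seqZ) a b M : a <= b -> 0 <= M ->
  (forall t n, a <= t <= b -> is_Cderive (fun s => f s n) t (g t n)) ->
  (forall t, a <= t <= b -> l2_le (g t) M) ->
  l2_le (seq_sub (f b) (f a)) (M * (b - a)).
Proof.
  intros Hab HM Hd Hg. apply l2_le_of_psum; [nra|]. intros N A HA HA2.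
  set (D := seq_sub (f b) (f a)) in *.
  rewrite (psum_lin_r N D (f b) (f a) 1 (Ropp 1) D) by (intros n; unfold D, seq_sub; rewrite RtoC_opp; ring).
  destruct (MVT_gen (fun s => psum N D (f s)) a b (fun s => psum N D (g s))) as [c [Hc Hc']].
  - intros t. rewrite Rmin_left, Rmax_right by auto. intros Ht.
    apply psum_is_derive; intros; apply Hd; lra.
  - intros t. rewrite Rmin_left, Rmax_right by auto. intros Ht.
    apply continuity_pt_filterlim, (ex_derive_continuous (V := R_NormedModule)).
    eexists; apply psum_is_derive; intros; apply Hd; lra.
  - rewrite Rmin_left, Rmax_right in Hc by auto.
    assert (H : psum N D (g c) <= A * M).
    { apply psum_CS; auto. lra. apply (Hg c Hc). }
    nra.
Qed.

Definition is_CRInt (f : R -> C) (a b : R) (l : C) : Prop :=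
  is_RInt (fun s => fst (f s)) a b (fst l) /\ is_RInt (fun s => snd (f s)) a b (snd l).

Lemma psum_is_RInt N u (g : R -> seqZ) a b J :
  (forall n, is_CRInt (fun s => g s n) a b (J n)) ->
  is_RInt (fun s => psum N u (g s)) a b (psum N u J).
Proof.
  intros H.
  assert (Hd : forall n, is_RInt (fun s => dot (u n) (g s n)) a b (dot (u n) (J n))).
  { intros n. destruct (H n) as [H1 H2]. unfold dot.
    apply (is_RInt_plus (V := R_NormedModule)).
    - apply (is_RInt_scal (V := R_NormedModule) (fun s => fst (g s n))), H1.
    - apply (is_RInt_scal (V := R_NormedModule) (fun s => snd (g s n))), H2. }
  unfold psum. induction N as [|N IH].
  - simpl. apply (is_RInt_plus (V := R_NormedModule)); apply Hd.
  - rewrite tech5.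
    apply (is_RInt_plus (V := R_NormedModule)
      (fun s => sum_f_R0 (fun k => dot (u (Z.of_nat k)) (g s (Z.of_nat k))
      + dot (u (- Z.of_nat (S k))%Z) (g s (- Z.of_nat (S k))%Z)) N)); auto.
    apply (is_RInt_plus (V := R_NormedModule)); apply Hd.
Qed.

(** A Minkowski inequality for integrals: pair the coordinatewise integral [J] with itself and
    estimate the scalar integrand by Cauchy-Schwarz. *)
Lemma l2_le_RInt (g : R -> seqZ) J a b M : a <= b -> 0 <= M ->
  (forall n, is_CRInt (fun s => g s n) a b (J n)) ->
  (forall s, a < s < b -> l2_le (g s) M) ->
  l2_le J (M * (b - a)).
Proof.
  intros Hab HM HJ Hg. apply l2_le_of_psum; [nra|]. intros N A HA HA2.
  replace (A * (M * (b - a))) with ((b - a) * (A * M)) by ring.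
  apply (is_RInt_le (fun s => psum N J (g s)) (fun _ => A * M) a b); auto.
  - apply psum_is_RInt; auto.
  - apply (is_RInt_const (V := R_NormedModule)).
  - intros s Hs. apply psum_CS; auto. lra. apply (Hg s Hs).
Qed.

(** * The power series of the propagator *)

Definition bdd (u : seqZ) (M : R) : Prop := forall n, Cmod (u n) <= M.

Lemma l2_le_bdd u M : l2_le u M -> bdd u M.
Proof. intros H n; apply l2_le_Cmod; auto. Qed.

Lemma bdd_iter_lap u M k : bdd u M -> bdd (Nat.iter k lap u) (4 ^ k * M).
Proof.
  intros H. induction k as [|k IH]; intros n; simpl; [rewrite Rmult_1_l; apply H|].
  unfold lap at 1. set (v := Nat.iter k lap u) in *.
  eapply Rle_trans; [apply Cmod_triangle|].
  eapply Rle_trans; [apply Rplus_le_compat_r, Cmod_triangle|].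
  rewrite Cmod_opp, Cmod_mult, Cmod_R, (Rabs_pos_eq 2) by lra.
  pose proof (IH (n + 1)%Z). pose proof (IH (n - 1)%Z). pose proof (IH n). lra.
Qed.

Lemma iter_lap_lin a b u v k n :
  Nat.iter k lap (fun m => a * u m + b * v m)%C n
  = (a * Nat.iter k lap u n + b * Nat.iter k lap v n)%C.
Proof.
  revert n; induction k as [|k IH]; intros n; simpl; auto.
  unfold lap at 1 3 5. rewrite !IH. ring.
Qed.

Lemma iter_lap_shift j u k n :
  Nat.iter k lap (fun m => u (m + j)%Z) n = Nat.iter k lap u (n + j)%Z.
Proof.
  revert n; induction k as [|k IH]; intros n; simpl; auto.
  unfold lap at 1 3. rewrite !IH.
  replace (n + 1 + j)%Z with (n + j + 1)%Z by lia.
  replace (n - 1 + j)%Z with (n + j - 1)%Z by lia. reflexivity.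
Qed.

(** The factor [t ^ k] is taken out, so that at a fixed index the group becomes a power series in t
    that can be differentiated term by term. *)
Definition propag_coef (kappa : R) (u : seqZ) (n : Z) (k : nat) : C :=
  ((Ci * RtoC kappa) ^ k / RtoC (INR (fact k)) * Nat.iter k lap u n)%C.

Lemma fst_RtoC_mult r z : fst (RtoC r * z)%C = r * fst z.
Proof. simpl; ring. Qed.

Lemma snd_RtoC_mult r z : snd (RtoC r * z)%C = r * snd z.
Proof. simpl; ring. Qed.

Lemma fst_Ci_mult r z : fst (Ci * RtoC r * z)%C = - r * snd z.
Proof. simpl; ring. Qed.

Lemma snd_Ci_mult r z : snd (Ci * RtoC r * z)%C = r * fst z.
Proof. simpl; ring. Qed.

Lemma propag_term kappa t u n k :
  ((Ci * RtoC (kappa * t)) ^ k / RtoC (INR (fact k)) * Nat.iter k lap u n)%C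
  = (RtoC (t ^ k) * propag_coef kappa u n k)%C.
Proof.
  unfold propag_coef. rewrite RtoC_mult, !Cpow_mult_l, RtoC_pow.
  unfold Cdiv; ring.
Qed.

Lemma propag_PSeries kappa t u n :
  propag kappa t u n = (PSeries (fun k => fst (propag_coef kappa u n k)) t,
                        PSeries (fun k => snd (propag_coef kappa u n k)) t).
Proof.
  unfold propag, CSeries, PSeries.
  f_equal; apply Series_ext; intros k; rewrite propag_term;
    [rewrite fst_RtoC_mult | rewrite snd_RtoC_mult]; apply Rmult_comm.
Qed.

Lemma Cmod_Ci : Cmod Ci = 1.
Proof.
  unfold Cmod, Ci; simpl. replace (_ + _) with 1 by ring. apply sqrt_1.
Qed.

Lemma INR_fact_pos k : 0 < INR (fact k).
Proof. apply lt_0_INR, lt_O_fact. Qed.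

Lemma Cmod_propag_coef kappa u n k M : 0 <= kappa -> bdd u M ->
  Cmod (propag_coef kappa u n k) <= (4 * kappa) ^ k / INR (fact k) * M.
Proof.
  intros Hk H. unfold propag_coef. pose proof (INR_fact_pos k).
  rewrite Cmod_mult, Cmod_div, Cmod_pow, Cmod_mult, !Cmod_R.
  - rewrite Cmod_Ci.
    rewrite Rmult_1_l, !Rabs_pos_eq by lra.
    rewrite Rpow_mult_distr.
    replace (4 ^ k * kappa ^ k / INR (fact k) * M)
      with (kappa ^ k / INR (fact k) * (4 ^ k * M)) by (field; lra).
    apply Rmult_le_compat_l; [|apply bdd_iter_lap; auto].
    apply Rdiv_le_0_compat; auto. apply pow_le; auto.
  - intros E; apply RtoC_inj in E; lra.
Qed.

Lemma exp_term_bound x k : 0 <= x -> x ^ k / INR (fact k) <= exp x.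
Proof.
  intros Hx. eapply Rle_trans; [|apply (exp_ge_taylor x k Hx)].
  assert (Hp : forall j, 0 <= x ^ j / INR (fact j)).
  { intros j. apply Rdiv_le_0_compat; [apply pow_le; auto|apply INR_fact_pos]. }
  destruct k; [simpl; lra|]. rewrite tech5.
  pose proof (cond_pos_sum (fun j => x ^ j / INR (fact j)) k Hp). lra.
Qed.

(** At radius |x| + 1 each term is at most one term of the series of exp (A (|x| + 1)), times [M];
    bounded terms there put x strictly inside the disc. *)
Lemma CV_radius_exp_type (a : nat -> R) A M x : 0 <= A ->
  (forall k, Rabs (a k) <= A ^ k / INR (fact k) * M) -> Rbar_lt (Rabs x) (CV_radius a).
Proof.
  intros HA H.
  assert (HM : 0 <= M).
  { specialize (H O). simpl in H. pose proof (Rabs_pos (a O)). lra. }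
  assert (Hx := Rabs_pos x).
  apply Rbar_lt_le_trans with (Rabs x + 1); [simpl; lra|].
  apply (CV_radius_bounded a). exists (exp (A * (Rabs x + 1)) * M). intros k.
  rewrite Rabs_mult, <- RPow_abs, (Rabs_pos_eq (Rabs x + 1)) by lra.
  eapply Rle_trans; [apply Rmult_le_compat_r; [apply pow_le; lra|apply H]|].
  replace (A ^ k / INR (fact k) * M * (Rabs x + 1) ^ k)
    with ((A * (Rabs x + 1)) ^ k / INR (fact k) * M)
    by (rewrite Rpow_mult_distr; unfold Rdiv; ring).
  apply Rmult_le_compat_r; auto. apply exp_term_bound. nra.
Qed.

Lemma Rabs_fst_le_Cmod z : Rabs (fst z) <= Cmod z.
Proof. eapply Rle_trans; [apply Rmax_l|apply Rmax_Cmod]. Qed.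

Lemma Rabs_snd_le_Cmod z : Rabs (snd z) <= Cmod z.
Proof. eapply Rle_trans; [apply Rmax_r|apply Rmax_Cmod]. Qed.

Lemma propag_CV kappa u M n t : 0 <= kappa -> bdd u M ->
  Rbar_lt (Rabs t) (CV_radius (fun k => fst (propag_coef kappa u n k))) /\
  Rbar_lt (Rabs t) (CV_radius (fun k => snd (propag_coef kappa u n k))).
Proof.
  intros Hk H. split; apply (CV_radius_exp_type _ (4 * kappa) M); try lra; intros k;
    (eapply Rle_trans; [|apply (Cmod_propag_coef kappa u n k M Hk H)]);
    [apply Rabs_fst_le_Cmod|apply Rabs_snd_le_Cmod].
Qed.

Lemma propag_coef_succ kappa u n k :
  (RtoC (INR (S k)) * propag_coef kappa u n (S k))%C
  = (Ci * RtoC kappa * propag_coef kappa (lap u) n k)%C.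
Proof.
  unfold propag_coef. rewrite Nat.iter_succ_r, fact_simpl, mult_INR, RtoC_mult, Cpow_S.
  field. split; intros E; apply RtoC_inj in E.
  - pose proof (INR_fact_pos k); lra.
  - assert (0 < INR (S k)) by (apply lt_0_INR; lia); lra.
Qed.

Lemma propag_derive kappa u M t n : 0 <= kappa -> bdd u M ->
  is_Cderive (fun s => propag kappa s u n) t (Ci * RtoC kappa * propag kappa t (lap u) n)%C.
Proof.
  intros Hk H. destruct (propag_CV kappa u M n t Hk H) as [H1 H2].
  assert (Hc := propag_coef_succ kappa u n).
  rewrite (propag_PSeries kappa t (lap u)). split; cbn [fst snd].
  - apply (is_derive_ext (PSeries (fun k => fst (propag_coef kappa u n k)))).
    { intros s; rewrite propag_PSeries; reflexivity. }
    match goal with |- is_derive _ _ ?x =>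
      replace x with (PSeries (PS_derive (fun k => fst (propag_coef kappa u n k))) t) end.
    { apply is_derive_PSeries, H1. }
    rewrite fst_Ci_mult. cbn [snd]. rewrite <- PSeries_scal. apply PSeries_ext; intros k.
    unfold PS_derive, PS_scal.
    rewrite <- fst_RtoC_mult, Hc. apply fst_Ci_mult.
  - apply (is_derive_ext (PSeries (fun k => snd (propag_coef kappa u n k)))).
    { intros s; rewrite propag_PSeries; reflexivity. }
    match goal with |- is_derive _ _ ?x =>
      replace x with (PSeries (PS_derive (fun k => snd (propag_coef kappa u n k))) t) end.
    { apply is_derive_PSeries, H2. }
    rewrite snd_Ci_mult. cbn [fst]. rewrite <- PSeries_scal. apply PSeries_ext; intros k.
    unfold PS_derive, PS_scal.
    rewrite <- snd_RtoC_mult, Hc. apply snd_Ci_mult.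
Qed.

Lemma propag_0 kappa u n : propag kappa 0 u n = u n.
Proof.
  rewrite propag_PSeries, !PSeries_0. unfold propag_coef; simpl.
  destruct (u n) as [x y]; simpl. f_equal; field.
Qed.

Lemma propag_is_pseries kappa u M t n : 0 <= kappa -> bdd u M ->
  is_pseries (fun k => fst (propag_coef kappa u n k)) t (fst (propag kappa t u n)) /\
  is_pseries (fun k => snd (propag_coef kappa u n k)) t (snd (propag kappa t u n)).
Proof.
  intros Hk H. destruct (propag_CV kappa u M n t Hk H) as [H1 H2].
  rewrite propag_PSeries.
  split; apply PSeries_correct, CV_radius_inside; assumption.
Qed.

Lemma propag_lin kappa t a b u v Mu Mv n : 0 <= kappa -> bdd u Mu -> bdd v Mv ->
  propag kappa t (fun m => a * u m + b * v m)%C n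
  = (a * propag kappa t u n + b * propag kappa t v n)%C.
Proof.
  intros Hk Hu Hv.
  destruct (propag_is_pseries kappa u Mu t n Hk Hu) as [U1 U2].
  destruct (propag_is_pseries kappa v Mv t n Hk Hv) as [V1 V2].
  assert (Hc : forall k, propag_coef kappa (fun m => a * u m + b * v m)%C n k
    = (a * propag_coef kappa u n k + b * propag_coef kappa v n k)%C).
  { intros k. unfold propag_coef. rewrite iter_lap_lin. ring. }
  rewrite propag_PSeries.
  assert (lin : forall (r1 r2 : R) f g (F G : R), is_pseries f t F -> is_pseries g t G ->
    is_pseries (fun k => r1 * f k + r2 * g k) t (r1 * F + r2 * G)).
  { intros r1 r2 f g F G HF HG.
    apply (is_pseries_plus (V := R_NormedModule) (PS_scal r1 f) (PS_scal r2 g));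
      apply (is_pseries_scal (V := R_NormedModule)); auto; apply Rmult_comm. }
  apply injective_projections; cbn [fst snd]; apply is_pseries_unique.
  (* Complex scalars mix the two real series: the real part of a z is fst a fst z - snd a snd z,
     hence the nested uses of [lin]. *)
  - pose proof (lin 1 1 _ _ _ _ (lin (fst a) (- snd a) _ _ _ _ U1 U2)
      (lin (fst b) (- snd b) _ _ _ _ V1 V2)) as L.
    replace (fst _) with (1 * (fst a * fst (propag kappa t u n) + - snd a * snd (propag kappa t u n))
      + 1 * (fst b * fst (propag kappa t v n) + - snd b * snd (propag kappa t v n)))
      by (cbn [fst Cplus Cmult]; ring).
    revert L. apply is_pseries_ext. intros k. rewrite Hc. cbn [fst Cplus Cmult].
    match goal with |- ?x = ?y => change (@eq R x y) end. ring.
  - pose proof (lin 1 1 _ _ _ _ (lin (fst a) (snd a) _ _ _ _ U2 U1)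
      (lin (fst b) (snd b) _ _ _ _ V2 V1)) as L.
    replace (snd _) with (1 * (fst a * snd (propag kappa t u n) + snd a * fst (propag kappa t u n))
      + 1 * (fst b * snd (propag kappa t v n) + snd b * fst (propag kappa t v n)))
      by (cbn [snd Cplus Cmult]; ring).
    revert L. apply is_pseries_ext. intros k. rewrite Hc. cbn [snd Cplus Cmult].
    match goal with |- ?x = ?y => change (@eq R x y) end. ring.
Qed.

Lemma propag_shift kappa t j u n :
  propag kappa t (fun m => u (m + j)%Z) n = propag kappa t u (n + j)%Z.
Proof.
  unfold propag. f_equal. apply functional_extensionality; intros k.
  rewrite iter_lap_shift. reflexivity.
Qed.

Lemma propag_sub kappa t u v Mu Mv n : 0 <= kappa -> bdd u Mu -> bdd v Mv ->
  propag kappa t (seq_sub u v) n = (propag kappa t u n - propag kappa t v n)%C.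
Proof.
  intros Hk Hu Hv.
  replace (seq_sub u v) with (fun m => RtoC 1 * u m + (- RtoC 1) * v m)%C.
  - rewrite (propag_lin kappa t _ _ u v Mu Mv) by auto. ring.
  - apply functional_extensionality; intros m. unfold seq_sub. ring.
Qed.

Lemma bdd_shift u M j : bdd u M -> bdd (fun n => u (n + j)%Z) M.
Proof. intros H n; apply H. Qed.

Lemma propag_bdiff kappa t u M n : 0 <= kappa -> bdd u M ->
  propag kappa t (bdiff u) n = bdiff (propag kappa t u) n.
Proof.
  intros Hk H. change (bdiff u) with (seq_sub u (fun m => u (m + -1)%Z)).
  rewrite (propag_sub kappa t _ _ M M) by (auto; apply (bdd_shift u M (-1)); auto).
  rewrite propag_shift. reflexivity.
Qed.

(** The group is moved onto the backward difference, which for the background is square summable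
    although [u] itself is only bounded. *)
Lemma propag_lap kappa t u M n : 0 <= kappa -> bdd (bdiff u) M ->
  propag kappa t (lap u) n
  = (propag kappa t (bdiff u) (n + 1)%Z - propag kappa t (bdiff u) n)%C.
Proof.
  intros Hk H. rewrite <- propag_shift.
  replace (lap u) with (seq_sub (fun m => bdiff u (m + 1)%Z) (bdiff u)).
  - apply (propag_sub kappa t (fun m => bdiff u (m + 1)%Z) (bdiff u) M M); auto.
    apply (bdd_shift (bdiff u)); auto.
  - apply functional_extensionality; intros m. rewrite lap_bdiff. reflexivity.
Qed.

Lemma l2_le_iter_lap u M k : l2_le u M -> l2_le (Nat.iter k lap u) (4 ^ k * M).
Proof.
  intros H. induction k as [|k IH]; simpl; [rewrite Rmult_1_l; auto|].
  rewrite Rmult_assoc. apply l2_le_lap, IH.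
Qed.

(* Crude a priori bound from the operator norm [4 * kappa] of the generator;
   unitarity is obtained below by an energy argument that needs it. *)
Lemma l2_le_propag_exp kappa t u M : 0 <= kappa -> l2_le u M ->
  l2_le (propag kappa t u) (exp (4 * kappa * Rabs t) * M).
Proof.
  intros Hk H. pose proof (Rabs_pos t) as Ht.
  set (term := fun k n => (RtoC (t ^ k) * propag_coef kappa u n k)%C).
  set (part := fun j n => (sum_f_R0 (fun k => fst (term k n)) j,
                           sum_f_R0 (fun k => snd (term k n)) j) : C).
  apply (l2_le_ptlim part _ _ 0).
  - intros n. destruct (propag_is_pseries kappa u M t n Hk (l2_le_bdd _ _ H)) as [H1 H2].
    split.
    + apply (is_lim_seq_ext (sum_n (fun k => scal (pow_n t k) (fst (propag_coef kappa u n k))))); auto.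
      intros j. rewrite sum_n_Reals. unfold part; cbn [fst]. apply sum_eq; intros k _.
      unfold term. rewrite fst_RtoC_mult, pow_n_pow. reflexivity.
    + apply (is_lim_seq_ext (sum_n (fun k => scal (pow_n t k) (snd (propag_coef kappa u n k))))); auto.
      intros j. rewrite sum_n_Reals. unfold part; cbn [snd]. apply sum_eq; intros k _.
      unfold term. rewrite snd_RtoC_mult, pow_n_pow. reflexivity.
  - intros j _.
    apply l2_le_weaken with (sum_f_R0 (fun k => (4 * kappa * Rabs t) ^ k / INR (fact k)) j * M).
    { apply Rmult_le_compat_r; [apply H|]. apply exp_ge_taylor. nra. }
    assert (Hterm : forall k, l2_le (term k) ((4 * kappa * Rabs t) ^ k / INR (fact k) * M)).
    { intros k. pose proof (INR_fact_pos k).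
      apply l2_le_ext with (seq_scal (RtoC (t ^ k) * ((Ci * RtoC kappa) ^ k / RtoC (INR (fact k))))
        (Nat.iter k lap u)).
      { intros n; unfold term, propag_coef, seq_scal; ring. }
      assert (Hf : RtoC (INR (fact k)) <> RtoC 0) by (intros E; apply RtoC_inj in E; lra).
      replace ((4 * kappa * Rabs t) ^ k / INR (fact k) * M) with
        (Cmod (RtoC (t ^ k) * ((Ci * RtoC kappa) ^ k / RtoC (INR (fact k)))) * (4 ^ k * M)).
      { apply l2_le_scal, l2_le_iter_lap, H. }
      rewrite Cmod_mult, Cmod_div, Cmod_pow, Cmod_mult, !Cmod_R by auto.
      rewrite Cmod_Ci.
      rewrite Rmult_1_l, <- RPow_abs, (Rabs_pos_eq kappa), (Rabs_pos_eq (INR _)) by lra.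
      rewrite !Rpow_mult_distr. field. lra. }
    induction j as [|j IH].
    + eapply l2_le_ext; [|apply (Hterm O)]. intros n. apply surjective_pairing.
    + rewrite tech5, Rmult_plus_distr_r.
      apply l2_le_ext with (seq_add (part j) (term (S j))); [|apply l2_le_add; auto].
      intros n. unfold seq_add, part. rewrite !tech5. reflexivity.
Qed.

(** * Energy estimates *)

Lemma psum_Ci N u : psum N (seq_scal Ci u) u = 0.
Proof.
  unfold psum. rewrite (sum_eq _ (fun _ => 0)), sum_cte; [ring|].
  intros; unfold dot, seq_scal; simpl; ring.
Qed.

(** Writing [v] as the forward shift of [w] reduces summation by parts to [psum_shift]. The two
    boundary terms are kept; each contains a value of [x] near the edge of the window. *)
Lemma psum_by_parts M x v :
  psum M v (fun n => x (n + 1)%Z - x n)%C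
  = - psum M x (bdiff v) + dot (x (Z.of_nat (S M))) (v (Z.of_nat M))
    - dot (x (- Z.of_nat (S M))%Z) (v (- Z.of_nat (S (S M)))%Z).
Proof.
  set (w := fun n => v (n - 1)%Z).
  rewrite (psum_lin_r M v (fun n => x (n + 1)%Z) x 1 (Ropp 1)) by (intros n; rewrite RtoC_opp; ring).
  rewrite (psum_lin_r M x v w 1 (Ropp 1) (bdiff v))
    by (intros n; unfold bdiff, w; rewrite RtoC_opp; ring).
  replace v with (fun n => w (n + 1)%Z) at 1
    by (apply functional_extensionality; intros n; unfold w; f_equal; lia).
  rewrite psum_shift, (psum_sym M w x), (psum_sym M v x).
  unfold dot, w.
  replace (Z.of_nat (S M) - 1)%Z with (Z.of_nat M) by lia.
  replace (- Z.of_nat (S M) - 1)%Z with (- Z.of_nat (S (S M)))%Z by lia. ring.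
Qed.

Lemma is_Cderive_sub_linear f t l c : is_Cderive f t l ->
  is_Cderive (fun s => f s - RtoC s * c)%C t (l - c)%C.
Proof.
  intros [H1 H2]. split.
  - apply (is_derive_ext (fun s => fst (f s) - s * fst c)); [intros s; simpl; ring|].
    apply (is_derive_minus (V := R_NormedModule)); auto.
    auto_derive; auto; ring.
  - apply (is_derive_ext (fun s => snd (f s) - s * snd c)); [intros s; simpl; ring|].
    apply (is_derive_minus (V := R_NormedModule)); auto.
    auto_derive; auto; ring.
Qed.

Lemma Cmod_Ci_mult r : 0 <= r -> Cmod (Ci * RtoC r) = r.
Proof. intros H. rewrite Cmod_mult, Cmod_Ci, Cmod_R, Rabs_pos_eq; auto; ring. Qed.

Lemma l2_le_Ci_scal r u M : 0 <= r -> l2_le u M ->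
  l2_le (seq_scal (Ci * RtoC r) u) (r * M).
Proof. intros Hr Hu. rewrite <- (Cmod_Ci_mult r Hr) at 2. apply l2_le_scal, Hu. Qed.

Lemma l2_le_propag_exp_on kappa T t u M : 0 <= kappa -> 0 <= t <= T -> l2_le u M ->
  l2_le (propag kappa t u) (exp (4 * kappa * T) * M).
Proof.
  intros Hk Ht Hu. eapply l2_le_weaken; [|apply l2_le_propag_exp; eauto].
  apply Rmult_le_compat_r; [apply Hu|]. rewrite Rabs_pos_eq by lra.
  destruct (Req_dec (4 * kappa * t) (4 * kappa * T)) as [->|]; [lra|].
  left; apply exp_increasing. assert (4 * kappa * t <= 4 * kappa * T) by nra. lra.
Qed.

(** Boundedness of [u] justifies the derivative, and only [lap u] has to be in l2; this is what
    makes the estimate applicable to the background. *)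
Lemma propag_increment kappa T u M L s t : 0 <= kappa -> bdd u M -> l2_le (lap u) L ->
  0 <= s -> s <= t -> t <= T ->
  l2_le (seq_sub (propag kappa t u) (propag kappa s u))
    (kappa * (exp (4 * kappa * T) * L) * (t - s)).
Proof.
  intros Hk Hu HL Hs Hst HtT. pose proof (exp_pos (4 * kappa * T)) as He.
  pose proof (proj1 HL) as HL0.
  assert (0 <= exp (4 * kappa * T) * L) by nra.
  apply (l2_le_mean_value (fun s => propag kappa s u)
    (fun r => seq_scal (Ci * RtoC kappa) (propag kappa r (lap u)))); auto.
  - nra.
  - intros r n _. apply (propag_derive kappa u M); auto.
  - intros r Hr. apply l2_le_Ci_scal; auto.
    apply l2_le_propag_exp_on; auto; lra.
Qed.

(** Mean value inequality for s -> propag s u - s c, where c is the derivative at time t: its own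
    derivative is an increment of the group on [lap u], hence of order h. The factor 4 comes from
    applying [lap] once more. *)
Lemma propag_taylor kappa T u M L h t : 0 <= kappa -> bdd u M -> l2_le (lap u) L ->
  0 <= t -> 0 <= h -> t + h <= T ->
  l2_le (fun n => propag kappa (t + h) u n - propag kappa t u n
                  - RtoC h * (Ci * RtoC kappa * propag kappa t (lap u) n))%C
    (kappa * (kappa * (exp (4 * kappa * T) * (4 * L))) * h ^ 2).
Proof.
  intros Hk Hu HL Ht Hh HT. pose proof (exp_pos (4 * kappa * T)) as He.
  pose proof (proj1 HL) as HL0. set (B := exp (4 * kappa * T) * (4 * L)).
  assert (HB : 0 <= B) by (unfold B; nra).
  set (c := fun n => (Ci * RtoC kappa * propag kappa t (lap u) n)%C).
  assert (H : l2_le (seq_sub (fun n => propag kappa (t + h) u n - RtoC (t + h) * c n)%C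
                             (fun n => propag kappa t u n - RtoC t * c n)%C)
                    (kappa * (kappa * B * h) * (t + h - t))).
  { apply (l2_le_mean_value (fun s n => propag kappa s u n - RtoC s * c n)%C
      (fun s => seq_scal (Ci * RtoC kappa)
        (seq_sub (propag kappa s (lap u)) (propag kappa t (lap u))))).
    - lra.
    - assert (0 <= kappa * B * h) by (apply Rmult_le_pos; [apply Rmult_le_pos|]; auto).
      apply Rmult_le_pos; auto.
    - intros s n _.
      replace (seq_scal _ _ n) with (Ci * RtoC kappa * propag kappa s (lap u) n - c n)%C
        by (unfold seq_scal, seq_sub, c; ring).
      apply is_Cderive_sub_linear, (propag_derive kappa u M); auto.
    - intros s Hs. apply l2_le_Ci_scal; auto.
      apply l2_le_weaken with (kappa * B * (s - t)).
      { assert (0 <= kappa * B) by nra. nra. }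
      apply (propag_increment kappa T (lap u) L (4 * L)); auto using l2_le_bdd, l2_le_lap; lra. }
  replace (kappa * (kappa * B) * h ^ 2) with (kappa * (kappa * B * h) * (t + h - t)) by ring.
  eapply l2_le_ext, H. intros n. unfold seq_sub, c. rewrite RtoC_plus. ring.
Qed.

(** The boundary terms of [psum_by_parts] vanish along growing windows, since [x] tends to 0 at both
    ends and [v] stays bounded. The window can be taken beyond any [N0]. *)
Lemma boundary_small x v A V e : l2_le x A -> l2_le v V -> 0 < e ->
  forall N0, exists M, (N0 <= M)%nat /\
  Rabs (dot (x (Z.of_nat (S M))) (v (Z.of_nat M))
    - dot (x (- Z.of_nat (S M))%Z) (v (- Z.of_nat (S (S M)))%Z)) <= e.
Proof.
  intros Hx Hv He N0. pose proof (proj1 Hv).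
  set (d := e / (2 * (V + 1))).
  assert (Hd : 0 < d) by (apply Rdiv_lt_0_compat; lra).
  assert (Hde : d * (2 * (V + 1)) = e) by (unfold d; field; lra).
  destruct (l2_le_zero_Cmod x A Hx d Hd) as [N HN].
  exists (Nat.max N0 N). split; [lia|].
  set (M := Nat.max N0 N).
  destruct (HN (S M)) as [H1 _]; [lia|]. destruct (HN M) as [_ H2]; [lia|].
  pose proof (dot_le_Cmod (x (Z.of_nat (S M))) (v (Z.of_nat M))).
  pose proof (dot_le_Cmod (x (- Z.of_nat (S M))%Z) (v (- Z.of_nat (S (S M)))%Z)).
  pose proof (l2_le_Cmod _ _ (Z.of_nat M) Hv).
  pose proof (l2_le_Cmod _ _ (- Z.of_nat (S (S M)))%Z Hv).
  pose proof (Cmod_ge_0 (v (Z.of_nat M))).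
  pose proof (Cmod_ge_0 (v (- Z.of_nat (S (S M)))%Z)).
  pose proof (Cmod_ge_0 (x (Z.of_nat (S M)))).
  pose proof (Cmod_ge_0 (x (- Z.of_nat (S M))%Z)).
  eapply Rle_trans; [apply Rabs_triang|]. rewrite Rabs_Ropp.
  assert (Cmod (x (Z.of_nat (S M))) * Cmod (v (Z.of_nat M)) <= d * V)
    by (apply Rmult_le_compat; lra).
  assert (Cmod (x (- Z.of_nat (S M))%Z) * Cmod (v (- Z.of_nat (S (S M)))%Z) <= d * V)
    by (apply Rmult_le_compat; lra).
  lra.
Qed.

(* [v = propag t u - z] solves [v' = i kappa lap v + i kappa lap z]; summation by
   parts gives [d/dt |v|^2 = 2 kappa Re <i propag t (bdiff u), bdiff z>].  Since
   [|v|^2] is followed over steps of length T/m with a quadratic error, no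
   differentiation under an infinite sum is needed. *)
Lemma propag_energy kappa T u z M A S0 beta : 0 <= kappa -> 0 <= T -> bdd u M ->
  l2_le (bdiff u) A -> 0 <= S0 -> sq_le (seq_sub u z) S0 ->
  (forall t, 0 <= t <= T -> forall N,
     2 * kappa * psum N (seq_scal Ci (propag kappa t (bdiff u))) (bdiff z) <= beta) ->
  sq_le (seq_sub (propag kappa T u) z) (S0 + beta * T).
Proof.
  intros Hk HT Hu HA HS0 Hz Hbeta.
  pose proof (l2_le_lap_bdiff u A HA) as HL. set (L := 2 * A) in *.
  pose proof (exp_pos (4 * kappa * T)) as He. pose proof (proj1 HL) as HL0.
  set (v := fun t => seq_sub (propag kappa t u) z).
  set (W := kappa * (exp (4 * kappa * T) * L)).
  set (Rm := kappa * (kappa * (exp (4 * kappa * T) * (4 * L)))).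
  assert (HeL : 0 <= exp (4 * kappa * T) * L) by nra.
  assert (HW : 0 <= W) by (unfold W; nra).
  assert (HRm : 0 <= Rm) by (unfold Rm; nra).
  (* A crude bound for |v| on [0, T], by the initial size plus the path length; it enters error
     terms only. *)
  set (V := sqrt S0 + W * T).
  assert (HV0 : 0 <= V) by (pose proof (sqrt_pos S0); unfold V; nra).
  assert (Hv : forall t, 0 <= t <= T -> l2_le (v t) V).
  { intros t Ht. apply l2_le_ext with
      (seq_add (seq_sub u z) (seq_sub (propag kappa t u) (propag kappa 0 u))).
    { intros n. unfold seq_add, v, seq_sub. rewrite propag_0. ring. }
    apply l2_le_weaken with (sqrt S0 + W * (t - 0)); [unfold V; nra|].
    apply l2_le_add.
    - split; [apply sqrt_pos|]. rewrite pow2_sqrt; auto.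
    - apply (propag_increment kappa T u M L); auto; lra. }
  (* In one step v changes by h w + r with |w| <= W and |r| <= Rm h^2. The pairing 2 <v, r> gives
     the first summand and |h w + r|^2 the second. *)
  set (K := 2 * V * Rm + (W + Rm * T) ^ 2).
  assert (Hstep : forall t h S, 0 <= t -> 0 <= h -> t + h <= T ->
    sq_le (v t) S -> sq_le (v (t + h)) (S + beta * h + K * h ^ 2)).
  { intros t h S Ht Hh HTh HS N0. apply le_epsilon; intros e Hepos.
    set (x := seq_scal Ci (propag kappa t (bdiff u))).
    set (w := fun n => (RtoC kappa * (x (n + 1)%Z - x n))%C).
    assert (Hx : l2_le x (Cmod Ci * (exp (4 * kappa * T) * A))).
    { apply l2_le_scal, l2_le_propag_exp_on; auto; lra. }
    assert (Hw : forall n, w n = (Ci * RtoC kappa * propag kappa t (lap u) n)%C).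
    { intros n. unfold w, x, seq_scal.
      rewrite (propag_lap kappa t u A) by auto using l2_le_bdd. ring. }
    assert (HwW : l2_le w W).
    { apply l2_le_ext with (seq_scal (Ci * RtoC kappa) (propag kappa t (lap u))).
      { intros n. rewrite Hw. reflexivity. }
      unfold W. apply l2_le_Ci_scal, l2_le_propag_exp_on; auto; lra. }
    set (r := fun n => (propag kappa (t + h) u n - propag kappa t u n - RtoC h * w n)%C).
    assert (Hr : l2_le r (Rm * h ^ 2)).
    { eapply l2_le_ext; [|apply (propag_taylor kappa T u M L h t); auto].
      intros n. unfold r. rewrite Hw. reflexivity. }
    set (y := fun n => (RtoC h * w n + RtoC 1 * r n)%C).
    assert (Hb : bdiff (v t) = seq_sub (propag kappa t (bdiff u)) (bdiff z)).
    { apply functional_extensionality; intros n. unfold seq_sub at 1.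
      rewrite (propag_bdiff kappa t u M) by auto. unfold bdiff, v, seq_sub. ring. }
    (* The boundary terms enter multiplied by 2 kappa h; adding 1 keeps the quotient meaningful when
       h = 0. *)
    assert (Hd : 0 < e / (2 * kappa * h + 1)) by (apply Rdiv_lt_0_compat; nra).
    assert (Hd2 : e / (2 * kappa * h + 1) * (2 * kappa * h + 1) = e)
      by (field; assert (0 <= kappa * h) by nra; lra).
    destruct (boundary_small x (v t) _ V _ Hx (Hv t ltac:(lra)) Hd N0) as [N [HN Hbd]].
    apply Rle_trans with (psum N (v (t + h)) (v (t + h))); [apply psum_mono; auto|].
    rewrite (psum_lin_sq N (v t) y 1 1)
      by (intros n; unfold y, r, v, seq_sub; ring).
    rewrite (psum_lin_r N (v t) w r h 1 y), (psum_lin_sq N w r h 1 y) by reflexivity.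
    assert (E1 : psum N (v t) r <= V * (Rm * h ^ 2)).
    { apply psum_CS; auto. apply Hr. apply Hv; lra. apply Hr. }
    assert (E2 : psum N w r <= W * (Rm * h ^ 2)).
    { apply psum_CS; auto. apply Hr. apply HwW. apply Hr. }
    assert (E3 : psum N w w <= W ^ 2) by apply HwW.
    assert (E4 : psum N r r <= (Rm * h ^ 2) ^ 2) by apply Hr.
    assert (E5 : psum N (v t) w = kappa * psum N (v t) (fun n => x (n + 1)%Z - x n)%C).
    { rewrite (psum_lin_r N (v t) (fun n => x (n + 1)%Z - x n)%C (fun _ => RtoC 0) kappa 0 w);
        [ring|]. intros n; unfold w; ring. }
    (* The difference of v is that of the evolved [u] minus that of [z]. The first part pairs to 0
       with its own multiple by i, so only the pairing with [bdiff z] survives. *)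
    rewrite psum_by_parts, Hb in E5.
    rewrite (psum_lin_r N x (propag kappa t (bdiff u)) (bdiff z) 1 (Ropp 1)) in E5
      by (intros n; unfold seq_sub; rewrite RtoC_opp; ring).
    unfold x in E5 at 1. rewrite psum_Ci in E5.
    pose proof (Hbeta t ltac:(lra) N) as E6. fold x in E6.
    match type of Hbd with Rabs ?b <= _ => set (bd := b) in * end.
    assert (E7 : psum N (v t) w = kappa * psum N x (bdiff z) + kappa * bd)
      by (rewrite E5; unfold bd; ring).
    apply Rabs_le_between in Hbd.
    pose proof (HS N) as E8.
    assert (F1 : 2 * h * psum N (v t) w <= beta * h + e).
    { rewrite E7.
      assert (2 * kappa * h * bd <= 2 * kappa * h * (e / (2 * kappa * h + 1)))
        by (apply Rmult_le_compat_l; [assert (0 <= kappa * h) by nra; lra|lra]).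
      assert (h * (2 * kappa * psum N x (bdiff z)) <= h * beta)
        by (apply Rmult_le_compat_l; auto).
      lra. }
    assert (F2 : h ^ 2 * psum N w w + 2 * h * 1 * psum N w r + 1 ^ 2 * psum N r r
      <= (W + Rm * T) ^ 2 * h ^ 2).
    { apply Rle_trans with ((W + Rm * h) ^ 2 * h ^ 2).
      - pose proof (pow2_ge_0 h).
        assert (h ^ 2 * psum N w w <= h ^ 2 * W ^ 2) by (apply Rmult_le_compat_l; auto).
        assert (2 * h * psum N w r <= 2 * h * (W * (Rm * h ^ 2)))
          by (apply Rmult_le_compat_l; lra).
        lra.
      - apply Rmult_le_compat_r; [apply pow2_ge_0|].
        apply pow_incr. assert (0 <= Rm * h) by nra.
        assert (Rm * h <= Rm * T) by (apply Rmult_le_compat_l; lra). lra. }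
    unfold K. lra. }
  (* With steps of length T/(m+1), the m+1 quadratic errors add up to K T^2/(m+1). *)
  assert (Hiter : forall m j, (j <= S m)%nat ->
    sq_le (v (INR j * (T / INR (S m))))
      (S0 + INR j * (beta * (T / INR (S m)) + K * (T / INR (S m)) ^ 2))).
  { intros m j. set (h := T / INR (S m)).
    assert (Hm : 0 < INR (S m)) by (apply lt_0_INR; lia).
    assert (Hh : 0 <= h) by (apply Rdiv_le_0_compat; auto).
    assert (HmT : INR (S m) * h = T) by (unfold h; field; lra).
    induction j as [|j IH]; intros Hj.
    - simpl INR. rewrite !Rmult_0_l, Rplus_0_r. intros N.
      replace (v 0) with (seq_sub u z); auto.
      apply functional_extensionality; intros n; unfold v, seq_sub. rewrite propag_0. auto.
    - assert (Hj' : INR (S j) * h <= T).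
      { rewrite <- HmT. apply Rmult_le_compat_r; auto. apply le_INR; auto. }
      rewrite S_INR in Hj'.
      pose proof (pos_INR j).
      specialize (Hstep (INR j * h) h _ ltac:(nra) Hh ltac:(lra) (IH ltac:(lia))).
      rewrite S_INR. replace ((INR j + 1) * h) with (INR j * h + h) by ring.
      intros N. eapply Rle_trans; [apply Hstep|]. lra. }
  intros N. apply le_epsilon; intros e Hepos.
  (* The step count is taken so large that K T^2/(m+1) <= e; the added 1 covers K T^2 = 0. *)
  destruct (archimed_cor1 (e / (K * T ^ 2 + 1))) as [m [Hm1 Hm2]].
  { apply Rdiv_lt_0_compat; auto. assert (0 <= K).
    { unfold K. pose proof (pow2_ge_0 (W + Rm * T)). assert (0 <= V * Rm) by nra. lra. }
    pose proof (pow2_ge_0 T). nra. }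
  destruct m as [|m]; [lia|].
  specialize (Hiter m (S m) (le_n _) N).
  assert (Hm : 0 < INR (S m)) by (apply lt_0_INR; lia).
  assert (HK : 0 <= K).
  { unfold K. pose proof (pow2_ge_0 (W + Rm * T)). assert (0 <= V * Rm) by nra. lra. }
  assert (HKT : 0 <= K * T ^ 2) by (pose proof (pow2_ge_0 T); nra).
  replace (INR (S m) * (T / INR (S m))) with T in Hiter by (field; lra).
  replace (INR (S m) * (beta * (T / INR (S m)) + K * (T / INR (S m)) ^ 2))
    with (beta * T + K * T ^ 2 * / INR (S m)) in Hiter by (field; lra).
  assert (K * T ^ 2 * / INR (S m) <= e).
  { apply Rle_trans with ((K * T ^ 2 + 1) * (e / (K * T ^ 2 + 1))).
    - apply Rmult_le_compat; try lra. left; apply Rinv_0_lt_compat; auto.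
    - right; field; lra. }
  unfold v in Hiter. lra.
Qed.

Lemma l2_le_propag kappa t u M : 0 <= kappa -> 0 <= t -> l2_le u M ->
  l2_le (propag kappa t u) M.
Proof.
  intros Hk Ht Hu. split; [apply Hu|].
  assert (H : sq_le (seq_sub (propag kappa t u) (fun _ => RtoC 0)) (M ^ 2 + 0 * t)).
  { apply (propag_energy kappa t u (fun _ => RtoC 0) M (2 * M)); auto using l2_le_bdd, l2_le_bdiff.
    - apply pow2_ge_0.
    - replace (seq_sub u (fun _ => RtoC 0)) with u; [apply Hu|].
      apply functional_extensionality; intros n; unfold seq_sub; ring.
    - intros s _ N. rewrite (psum_lin_r N _ u u 0 0); [lra|].
      intros n; unfold bdiff; ring. }
  replace (propag kappa t u) with (seq_sub (propag kappa t u) (fun _ => RtoC 0)).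
  - intros N. specialize (H N). lra.
  - apply functional_extensionality; intros n; unfold seq_sub; ring.
Qed.

(* The Fourier multiplier [|exp (- i w t) - 1| <= sqrt (2 w t)] with
   [w = 4 kappa sin^2 (theta / 2)]; this is where [sqrt (2 kappa t)] comes from. *)
Lemma propag_sub_id kappa t u M A : 0 <= kappa -> 0 <= t -> bdd u M -> l2_le (bdiff u) A ->
  l2_le (seq_sub (propag kappa t u) u) (sqrt (2 * kappa) * A * sqrt t).
Proof.
  intros Hk Ht Hu HA. pose proof (proj1 HA) as HA0. split.
  - pose proof (sqrt_pos (2 * kappa)). pose proof (sqrt_pos t).
    assert (0 <= sqrt (2 * kappa) * A) by nra. nra.
  (* The energy starts at |u - u|^2 = 0 and grows at rate at most beta = 2 kappa A^2, since
     contractivity keeps both factors of the pairing below A. *)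
  - replace ((sqrt (2 * kappa) * A * sqrt t) ^ 2) with (0 + 2 * kappa * A ^ 2 * t).
    + apply (propag_energy kappa t u u M A); auto; [lra| |].
      * intros N. replace (seq_sub u u) with (fun _ : Z => RtoC 0)
          by (apply functional_extensionality; intros n; unfold seq_sub; ring).
        pose proof (proj2 l2_le_zero N). lra.
      * intros s Hs N. apply Rmult_le_compat_l; [lra|].
        replace (A ^ 2) with (A * A) by ring.
        assert (Hx : l2_le (seq_scal Ci (propag kappa s (bdiff u))) A).
        { replace A with (Cmod Ci * A) by (rewrite Cmod_Ci; ring).
          apply l2_le_scal, l2_le_propag; auto; lra. }
        apply psum_CS; auto; [apply Hx|apply HA].
    + rewrite !Rpow_mult_distr, !pow2_sqrt by lra. ring.
Qed.

(** With contractivity available, the exponential factor of [propag_increment] disappears; 4 kappa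
    bounds the norm of the generator. *)
Lemma propag_lipschitz kappa u M s t : 0 <= kappa -> l2_le u M -> 0 <= s -> 0 <= t ->
  l2_le (seq_sub (propag kappa t u) (propag kappa s u)) (4 * kappa * M * Rabs (t - s)).
Proof.
  intros Hk Hu.
  assert (Hmain : forall s t, 0 <= s -> s <= t ->
    l2_le (seq_sub (propag kappa t u) (propag kappa s u)) (4 * kappa * M * (t - s))).
  { clear s t. intros s t Hs Hst.
    apply (l2_le_mean_value (fun s => propag kappa s u)
      (fun r => seq_scal (Ci * RtoC kappa) (propag kappa r (lap u)))); auto.
    - pose proof (proj1 Hu). nra.
    - intros r n _. apply (propag_derive kappa u M); auto using l2_le_bdd.
    - intros r Hr. replace (4 * kappa * M) with (kappa * (4 * M)) by ring.
      apply l2_le_Ci_scal, l2_le_propag, l2_le_lap; auto; lra. }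
  intros Hs Ht. destruct (Rle_dec s t) as [Hst|Hst].
  - rewrite Rabs_pos_eq by lra. auto.
  - rewrite Rabs_left1 by lra. rewrite Ropp_minus_distr.
    apply l2_le_ext with (seq_scal (- RtoC 1)%C (seq_sub (propag kappa s u) (propag kappa t u))).
    { intros n; unfold seq_scal, seq_sub; ring. }
    replace (4 * kappa * M * (s - t)) with (Cmod (- RtoC 1) * (4 * kappa * M * (s - t)))
      by (rewrite Cmod_opp, Cmod_1; ring).
    apply l2_le_scal, Hmain; lra.
Qed.

(** * The nonlinearity *)

Lemma rpow_sq_le x S p : 0 <= x <= S -> 0 < S -> 1 <= p ->
  rpow (Rabs (x ^ 2)) (p - 1) <= Rpower S (2 * p - 2).
Proof.
  intros Hx HS Hp. rewrite Rabs_pos_eq by apply pow2_ge_0. unfold rpow.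
  destruct (Req_EM_T (x ^ 2) 0) as [E|E].
  (* At x = 0 the convention for 0^0 matters: for p = 1 both sides equal 1, otherwise the left side
     is 0. *)
  - destruct (Req_EM_T (p - 1) 0) as [E'|E'].
    + replace (2 * p - 2) with 0 by lra. rewrite Rpower_O; lra.
    + left. apply exp_pos.
  - assert (Hx0 : 0 < x) by (destruct (Req_dec x 0) as [->|]; [simpl in E|]; lra).
    rewrite <- Rpower_pow by auto. rewrite Rpower_mult.
    replace (INR 2 * (p - 1)) with (2 * p - 2) by (simpl; ring).
    apply Rle_Rpower_l; lra.
Qed.

(** Factoring x^2 - y^2 keeps the small factor |x - y| visible. The factor x + y, times one more
    modulus, later completes S^(2p-2) to S^(2p). *)
Lemma F_sq_diff F K p x y S : F_hyp F K p -> 0 < K -> 1 <= p -> 0 < S ->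
  0 <= x <= S -> 0 <= y <= S ->
  Rabs (F (x ^ 2) - F (y ^ 2)) <= 2 * K * Rpower S (2 * p - 2) * Rabs (x - y) * (x + y).
Proof.
  intros (_ & HF & _) HK Hp HS Hx Hy.
  eapply Rle_trans; [apply HF; apply pow2_ge_0|].
  replace (x ^ 2 - y ^ 2) with ((x - y) * (x + y)) by ring.
  rewrite Rabs_mult, (Rabs_pos_eq (x + y)) by lra. rewrite <- Rmult_assoc.
  apply Rmult_le_compat_r; [lra|]. apply Rmult_le_compat_r; [apply Rabs_pos|].
  pose proof (rpow_sq_le x S p Hx HS Hp). pose proof (rpow_sq_le y S p Hy HS Hp). nra.
Qed.

Lemma Rabs_Cmod_sub z w : Rabs (Cmod z - Cmod w) <= Cmod (z - w).
Proof.
  pose proof (Cmod_triangle (z - w) w) as H1. pose proof (Cmod_triangle (w - z) z) as H2.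
  replace (z - w + w)%C with z in H1 by ring. replace (w - z + z)%C with w in H2 by ring.
  replace (Cmod (w - z)) with (Cmod (z - w)) in H2
    by (rewrite <- Cmod_opp; f_equal; ring).
  apply Rabs_le; lra.
Qed.

(** Arbitrary bounds Z, A, d stand in for the three norms of the background, so the estimates below
    need no suprema or series; the norms are put in at the very end. *)
Record background (kappa q0 K p : R) (F : R -> R) (zeta : seqZ) (Z A d : R) : Prop := {
  bg_kappa : 0 < kappa;
  bg_q0 : 0 < q0;
  bg_K : 0 < K;
  bg_p : 1 <= p;
  bg_F : F_hyp F K p;
  bg_bdd : bdd zeta Z;
  bg_diff : l2_le (bdiff zeta) A;
  bg_def : l2_le (mod_defect q0 zeta) d }.

Lemma bg_Z kappa q0 K p F zeta Z A d : background kappa q0 K p F zeta Z A d -> 0 <= Z.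
Proof. intros H. eapply Rle_trans; [apply (Cmod_ge_0 (zeta 0%Z))|apply (bg_bdd _ _ _ _ _ _ _ _ _ H)]. Qed.

Lemma Rpower_2p S p : 0 < S -> Rpower S (2 * p) = Rpower S (2 * p - 2) * (S * S).
Proof.
  intros HS. replace (S * S) with (Rpower S 2).
  - rewrite <- Rpower_plus. f_equal; ring.
  - replace 2 with (INR 2) by (simpl; ring). rewrite Rpower_pow by auto. ring.
Qed.

(** Square summability comes from one factor only: | |phi + zeta| - q0 | <= |phi| + | |zeta| - q0 |.
    The remaining factors are bounded through S. *)
Lemma nonlin_l2 kappa q0 K p F zeta Z A d phi r :
  background kappa q0 K p F zeta Z A d -> l2_le phi r ->
  l2_le (nonlin F q0 zeta phi) (2 * K * Rpower (r + Z + q0) (2 * p) * (r + d)).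
Proof.
  intros B Hphi. pose proof (bg_Z _ _ _ _ _ _ _ _ _ B) as HZ.
  destruct B as [Hkappa Hq0 HK Hp HF Hbdd _ Hdef]. pose proof (proj1 Hphi) as Hr.
  set (S := r + Z + q0). assert (HS : 0 < S) by (unfold S; lra).
  pose proof (exp_pos ((2 * p) * ln S)) as HP. fold (Rpower S (2 * p)) in HP.
  apply (l2_le_dom_add _ _ phi (mod_defect q0 zeta)); auto.
  { apply Rmult_le_pos; lra. }
  intros n. unfold nonlin. rewrite Cmod_mult, Cmod_R.
  set (a := Cmod (phi n + zeta n)%C).
  assert (Ha0 : 0 <= a) by apply Cmod_ge_0.
  assert (Ha : a <= r + Z).
  { eapply Rle_trans; [apply Cmod_triangle|].
    apply Rplus_le_compat; [apply l2_le_Cmod; auto|apply Hbdd]. }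
  assert (Hdist : Rabs (a - q0) <= Cmod (phi n) + Cmod (mod_defect q0 zeta n)).
  { replace (a - q0) with ((a - Cmod (zeta n)) + (Cmod (zeta n) - q0)) by ring.
    eapply Rle_trans; [apply Rabs_triang|]. unfold mod_defect. rewrite Cmod_R.
    apply Rplus_le_compat_r. eapply Rle_trans; [apply Rabs_Cmod_sub|].
    right; f_equal; ring. }
  pose proof (F_sq_diff F K p a q0 S HF HK Hp HS ltac:(unfold S; lra) ltac:(unfold S; lra)) as HFd.
  rewrite (Rpower_2p S p HS) in *. pose proof (exp_pos ((2 * p - 2) * ln S)) as HP'.
  fold (Rpower S (2 * p - 2)) in HP'. set (P := Rpower S (2 * p - 2)) in *.
  set (D := Cmod (phi n) + Cmod (mod_defect q0 zeta n)) in *.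
  assert (HKP : 0 <= 2 * K * P) by (apply Rmult_le_pos; lra).
  apply Rle_trans with (2 * K * P * Rabs (a - q0) * (a + q0) * a).
  { apply Rmult_le_compat_r; auto. }
  replace (2 * K * (P * (S * S)) * D) with (2 * K * P * D * (S * S)) by ring.
  rewrite Rmult_assoc. pose proof (Rabs_pos (a - q0)).
  apply Rmult_le_compat.
  - apply Rmult_le_pos; auto.
  - apply Rmult_le_pos; lra.
  - apply Rmult_le_compat_l; auto.
  - apply Rmult_le_compat; unfold S; lra.
Qed.

Lemma nonlin_lipschitz kappa q0 K p F zeta Z A d phi psi r D :
  background kappa q0 K p F zeta Z A d -> l2_le phi r -> l2_le psi r ->
  l2_le (seq_sub phi psi) D ->
  l2_le (seq_sub (nonlin F q0 zeta phi) (nonlin F q0 zeta psi))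
    (6 * K * Rpower (r + Z + q0) (2 * p) * D).
Proof.
  intros B Hphi Hpsi HD. pose proof (bg_Z _ _ _ _ _ _ _ _ _ B) as HZ.
  destruct B as [Hkappa Hq0 HK Hp HF Hbdd _ _]. pose proof (proj1 Hphi) as Hr.
  set (S := r + Z + q0). assert (HS : 0 < S) by (unfold S; lra).
  pose proof (exp_pos ((2 * p) * ln S)) as HP. fold (Rpower S (2 * p)) in HP.
  assert (HKS : 0 <= 6 * K * Rpower S (2 * p)) by (apply Rmult_le_pos; lra).
  apply l2_le_dom with (seq_scal (RtoC (6 * K * Rpower S (2 * p))) (seq_sub phi psi)).
  { apply Rmult_le_pos; [auto|apply HD]. }
  2: { replace (6 * K * Rpower S (2 * p)) with (Cmod (RtoC (6 * K * Rpower S (2 * p)))) at 2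
         by (rewrite Cmod_R, Rabs_pos_eq; auto). apply l2_le_scal, HD. }
  intros n. unfold seq_scal. rewrite Cmod_mult, Cmod_R, Rabs_pos_eq by auto.
  unfold seq_sub, nonlin.
  set (a := (phi n + zeta n)%C). set (b := (psi n + zeta n)%C).
  replace (phi n - psi n)%C with (a - b)%C by (unfold a, b; ring).
  assert (Hbound : forall w, Cmod w <= r -> 0 <= Cmod (w + zeta n) <= S).
  { intros w Hw. split; [apply Cmod_ge_0|]. eapply Rle_trans; [apply Cmod_triangle|].
    specialize (Hbdd n). unfold S; lra. }
  pose proof (Hbound (phi n) (l2_le_Cmod _ _ n Hphi)) as Ha. fold a in Ha.
  pose proof (Hbound (psi n) (l2_le_Cmod _ _ n Hpsi)) as Hb. fold b in Hb.
  pose proof (F_sq_diff F K p _ _ S HF HK Hp HS Ha Hb) as H1.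
  pose proof (F_sq_diff F K p (Cmod b) q0 S HF HK Hp HS Hb ltac:(unfold S; lra)) as H2.
  pose proof (Rabs_Cmod_sub a b) as Hab. pose proof (Cmod_ge_0 (a - b)) as Hab0.
  rewrite (Rpower_2p S p HS) in *. pose proof (exp_pos ((2 * p - 2) * ln S)) as HP'.
  fold (Rpower S (2 * p - 2)) in HP'. set (P := Rpower S (2 * p - 2)) in *.
  (* The constant 6 is 4 + 2: the change of F contributes 2 K P times (2 S) S, the change of the
     linear factor 2 K P times S^2, using | |b|^2 - q0^2 | <= S^2. *)
  replace (RtoC (F (Cmod a ^ 2) - F (q0 ^ 2))%R * a - RtoC (F (Cmod b ^ 2) - F (q0 ^ 2))%R * b)%C
    with (RtoC (F (Cmod a ^ 2) - F (Cmod b ^ 2))%R * a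
          + RtoC (F (Cmod b ^ 2) - F (q0 ^ 2))%R * (a - b))%C
    by (rewrite !RtoC_minus; ring).
  eapply Rle_trans; [apply Cmod_triangle|]. rewrite !Cmod_mult, !Cmod_R.
  assert (HKP : 0 <= 2 * K * P) by (apply Rmult_le_pos; lra).
  assert (E1 : Rabs (F (Cmod a ^ 2) - F (Cmod b ^ 2)) * Cmod a
    <= 2 * K * P * Cmod (a - b) * (2 * S) * S).
  { apply Rmult_le_compat; try lra; [apply Rabs_pos|].
    eapply Rle_trans; [apply H1|]. pose proof (Rabs_pos (Cmod a - Cmod b)).
    apply Rmult_le_compat; try lra.
    - apply Rmult_le_pos; auto.
    - apply Rmult_le_compat_l; auto. }
  assert (E2 : Rabs (F (Cmod b ^ 2) - F (q0 ^ 2)) * Cmod (a - b)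
    <= 2 * K * P * (S * S) * Cmod (a - b)).
  { apply Rmult_le_compat_r; auto. eapply Rle_trans; [apply H2|].
    rewrite Rmult_assoc. apply Rmult_le_compat_l; auto.
    replace (Rabs (Cmod b - q0) * (Cmod b + q0)) with (Rabs (Cmod b ^ 2 - q0 ^ 2)).
    - assert (q0 <= S) by (unfold S; lra). apply Rabs_le; nra.
    - replace (Cmod b ^ 2 - q0 ^ 2) with ((Cmod b - q0) * (Cmod b + q0)) by ring.
      rewrite Rabs_mult, (Rabs_pos_eq (_ + _)); lra. }
  lra.
Qed.

(** A crude bound for integrability and regularity in time. The size of the Duhamel map is estimated
    differently, since 2 kappa A here would produce a term linear in T. *)
Lemma forcing_l2 kappa gamma q0 K p F zeta Z A d phi r :
  background kappa q0 K p F zeta Z A d -> l2_le phi r ->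
  l2_le (forcing kappa gamma F q0 zeta phi)
    (kappa * (2 * A) + Rabs gamma * (2 * K * Rpower (r + Z + q0) (2 * p) * (r + d))).
Proof.
  intros B Hphi. pose proof (bg_kappa _ _ _ _ _ _ _ _ _ B).
  replace kappa with (Cmod (RtoC kappa)) at 2 by (rewrite Cmod_R, Rabs_pos_eq; lra).
  rewrite <- Cmod_R.
  apply (l2_le_add (seq_scal (RtoC kappa) (lap zeta))
    (seq_scal (RtoC gamma) (nonlin F q0 zeta phi))); apply l2_le_scal.
  - apply l2_le_lap_bdiff, (bg_diff _ _ _ _ _ _ _ _ _ B).
  - eapply nonlin_l2; eauto.
Qed.

Lemma forcing_lipschitz kappa gamma q0 K p F zeta Z A d phi psi r D :
  background kappa q0 K p F zeta Z A d -> l2_le phi r -> l2_le psi r ->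
  l2_le (seq_sub phi psi) D ->
  l2_le (seq_sub (forcing kappa gamma F q0 zeta phi) (forcing kappa gamma F q0 zeta psi))
    (Rabs gamma * (6 * K * Rpower (r + Z + q0) (2 * p) * D)).
Proof.
  intros B Hphi Hpsi HD. rewrite <- Cmod_R.
  apply l2_le_ext with
    (seq_scal (RtoC gamma) (seq_sub (nonlin F q0 zeta phi) (nonlin F q0 zeta psi))).
  - intros n. unfold seq_scal, seq_sub, forcing. ring.
  - apply l2_le_scal. eapply nonlin_lipschitz; eauto.
Qed.

(** * The Duhamel map *)

Lemma is_CRInt_C_RInt (f : R -> C) a b l : is_CRInt f a b l ->
  @ex_RInt C_R_NormedModule f a b /\ @RInt C_R_CompleteNormedModule f a b = l.
Proof.
  intros [H1 H2].
  assert (H : @is_RInt C_R_NormedModule f a b l).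
  { rewrite (surjective_pairing l).
    apply (is_RInt_fct_extend_pair (U := R_NormedModule) (V := R_NormedModule)); auto. }
  split; [exists l; exact H|]. apply (is_RInt_unique (V := C_R_CompleteNormedModule)), H.
Qed.

Lemma C_RInt_is_CRInt (f : R -> C) a b : @ex_RInt C_R_NormedModule f a b ->
  is_CRInt f a b (@RInt C_R_CompleteNormedModule f a b).
Proof.
  intros H. apply (RInt_correct (V := C_R_CompleteNormedModule)) in H.
  split.
  - apply (is_RInt_fct_extend_fst (U := R_NormedModule) (V := R_NormedModule)), H.
  - apply (is_RInt_fct_extend_snd (U := R_NormedModule) (V := R_NormedModule)), H.
Qed.

Lemma is_CRInt_ext f g a b l : a <= b -> (forall s, a < s < b -> f s = g s) ->
  is_CRInt f a b l -> is_CRInt g a b l.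
Proof.
  intros Hab H [H1 H2]. split; [revert H1|revert H2]; apply is_RInt_ext;
    rewrite Rmin_left, Rmax_right by auto; intros s Hs; rewrite H; auto.
Qed.

Lemma is_RInt_lin (f g : R -> R) a b c e F G : is_RInt f a b F -> is_RInt g a b G ->
  is_RInt (fun s => c * f s + e * g s) a b (c * F + e * G).
Proof.
  intros Hf Hg. apply (is_RInt_plus (V := R_NormedModule) (fun s => c * f s) (fun s => e * g s));
    apply (is_RInt_scal (V := R_NormedModule)); auto.
Qed.

Lemma is_CRInt_lin f g a b (c e : C) F G : is_CRInt f a b F -> is_CRInt g a b G ->
  is_CRInt (fun s => c * f s + e * g s)%C a b (c * F + e * G)%C.
Proof.
  intros [F1 F2] [G1 G2]. split.
  - pose proof (is_RInt_lin _ _ _ _ 1 1 _ _ (is_RInt_lin _ _ _ _ (fst c) (- snd c) _ _ F1 F2)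
      (is_RInt_lin _ _ _ _ (fst e) (- snd e) _ _ G1 G2)) as L.
    replace (fst _) with (1 * (fst c * fst F + - snd c * snd F)
      + 1 * (fst e * fst G + - snd e * snd G)) by (cbn [fst Cplus Cmult]; ring).
    revert L. apply is_RInt_ext. intros s _. cbn [fst Cplus Cmult].
    match goal with |- ?x = ?y => change (@eq R x y) end. ring.
  - pose proof (is_RInt_lin _ _ _ _ 1 1 _ _ (is_RInt_lin _ _ _ _ (fst c) (snd c) _ _ F2 F1)
      (is_RInt_lin _ _ _ _ (fst e) (snd e) _ _ G2 G1)) as L.
    replace (snd _) with (1 * (fst c * snd F + snd c * fst F)
      + 1 * (fst e * snd G + snd e * fst G)) by (cbn [snd Cplus Cmult]; ring).
    revert L. apply is_RInt_ext. intros s _. cbn [snd Cplus Cmult].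
    match goal with |- ?x = ?y => change (@eq R x y) end. ring.
Qed.

Lemma is_RInt_split (f : R -> R) a b c l : a <= b <= c -> is_RInt f a c l ->
  exists l1 l2, is_RInt f a b l1 /\ is_RInt f b c l2 /\ l = l1 + l2.
Proof.
  intros Hb H.
  assert (E : ex_RInt f a c) by (exists l; auto).
  destruct (ex_RInt_Chasles_1 (V := R_CompleteNormedModule) f a b c Hb E) as [l1 H1].
  destruct (ex_RInt_Chasles_2 (V := R_CompleteNormedModule) f a b c Hb E) as [l2 H2].
  exists l1, l2. repeat split; auto.
  rewrite <- (is_RInt_unique (V := R_CompleteNormedModule) _ _ _ _ H).
  apply (is_RInt_unique (V := R_CompleteNormedModule)).
  apply (is_RInt_Chasles (V := R_NormedModule) f a b c); auto.
Qed.

Lemma is_CRInt_split f a b c l : a <= b <= c -> is_CRInt f a c l ->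
  exists l1 l2, is_CRInt f a b l1 /\ is_CRInt f b c l2 /\ l = (l1 + l2)%C.
Proof.
  intros Hb [H1 H2].
  destruct (is_RInt_split _ a b c _ Hb H1) as (x1 & x2 & X1 & X2 & X3).
  destruct (is_RInt_split _ a b c _ Hb H2) as (y1 & y2 & Y1 & Y2 & Y3).
  exists (x1, y1), (x2, y2). repeat split; auto.
  apply injective_projections; auto.
Qed.

Definition l2_cont (T : R) (f : R -> seqZ) : Prop :=
  forall t, 0 <= t <= T -> forall e, 0 < e -> exists d, 0 < d /\
  forall s, 0 <= s <= T -> Rabs (s - t) < d -> l2_le (seq_sub (f s) (f t)) e.

Lemma continuous_eps (f : R -> R) x :
  (forall e, 0 < e -> exists d, 0 < d /\ forall y, Rabs (y - x) < d -> Rabs (f y - f x) < e) ->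
  continuous f x.
Proof.
  intros H. apply filterlim_locally. intros e.
  destruct (H e (cond_pos e)) as [d [Hd Hy]].
  exists (mkposreal d Hd). intros y Hyd. apply Hy, Hyd.
Qed.

(** Composing with this retraction onto [0, t] extends the integrand continuously to the whole line,
    so continuity at the endpoints is two-sided. *)
Definition clamp (t s : R) : R := Rmax 0 (Rmin t s).

Lemma clamp_id t s : 0 <= s <= t -> clamp t s = s.
Proof. intros H. unfold clamp. rewrite Rmin_right, Rmax_right; lra. Qed.

Lemma clamp_range t s : 0 <= t -> 0 <= clamp t s <= t.
Proof.
  intros H. unfold clamp. split; [apply Rmax_l|]. apply Rmax_lub; auto. apply Rmin_l.
Qed.

Lemma clamp_lipschitz t x y : 0 <= t -> Rabs (clamp t y - clamp t x) <= Rabs (y - x).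
Proof.
  intros H. unfold clamp, Rmin. destruct (Rle_dec t y), (Rle_dec t x);
    unfold Rmax; repeat match goal with
    | |- context [Rle_dec ?a ?b] => destruct (Rle_dec a b) end;
    unfold Rabs; repeat match goal with
    | |- context [Rcase_abs ?a] => destruct (Rcase_abs a) end; lra.
Qed.

Lemma duhamel_integrable kappa T f B t n : 0 <= kappa -> l2_cont T f -> 0 <= t <= T ->
  (forall s, 0 <= s <= T -> l2_le (f s) B) ->
  exists l, is_CRInt (fun s => propag kappa (t - s) (f s) n) 0 t l.
Proof.
  intros Hk Hf Ht HB. assert (HB0 : 0 <= B) by (apply (HB 0); lra).
  set (h := fun s => propag kappa (t - clamp t s) (f (clamp t s)) n).
  assert (Hh : forall x e, 0 < e -> exists d, 0 < d /\
    forall y, Rabs (y - x) < d -> Cmod (h y - h x) < e).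
  { intros x e He.
    pose proof (clamp_range t x ltac:(lra)) as Hx.
    destruct (Hf (clamp t x) ltac:(lra) (e / 2) ltac:(lra)) as [d [Hd Hd']].
    set (L := 4 * kappa * B). assert (HL : 0 <= L) by (unfold L; repeat first [lra | apply Rmult_le_pos]).
    exists (Rmin d (e / (2 * (L + 1)))). split.
    { apply Rmin_pos; auto. apply Rdiv_lt_0_compat; lra. }
    intros y Hy.
    assert (Hy1 : Rabs (y - x) < d) by (eapply Rlt_le_trans; [apply Hy|apply Rmin_l]).
    assert (Hy2 : Rabs (y - x) < e / (2 * (L + 1))) by (eapply Rlt_le_trans; [apply Hy|apply Rmin_r]).
    pose proof (clamp_lipschitz t x y ltac:(lra)) as Hc.
    pose proof (clamp_range t y ltac:(lra)) as Hyr.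
    unfold h. set (cx := clamp t x) in *. set (cy := clamp t y) in *.
    specialize (Hd' cy ltac:(lra) ltac:(lra)).
    pose proof (HB cy ltac:(lra)) as By. pose proof (HB cx ltac:(lra)) as Bx.
    pose proof (l2_le_Cmod _ _ n (l2_le_propag kappa (t - cy) _ _ Hk ltac:(lra) Hd')) as E1.
    rewrite (propag_sub kappa (t - cy) _ _ B B) in E1 by auto using l2_le_bdd.
    pose proof (l2_le_Cmod _ _ n (propag_lipschitz kappa (f cx) B (t - cx) (t - cy) Hk Bx
      ltac:(lra) ltac:(lra))) as E2. unfold seq_sub in E2.
    replace (t - cy - (t - cx)) with (- (cy - cx)) in E2 by ring.
    rewrite Rabs_Ropp in E2. fold L in E2.
    (* First the sequence changes at a fixed time, which contractivity controls, then the time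
       changes at a fixed sequence; each part accounts for e / 2. *)
    replace (propag kappa (t - cy) (f cy) n - propag kappa (t - cx) (f cx) n)%C
      with ((propag kappa (t - cy) (f cy) n - propag kappa (t - cy) (f cx) n)
        + (propag kappa (t - cy) (f cx) n - propag kappa (t - cx) (f cx) n))%C by ring.
    eapply Rle_lt_trans; [apply Cmod_triangle|].
    assert (L * Rabs (cy - cx) < e / 2).
    { apply Rle_lt_trans with (L * (e / (2 * (L + 1)))); [apply Rmult_le_compat_l; lra|].
      apply Rmult_lt_reg_r with (2 * (L + 1)); [lra|]. field_simplify; lra. }
    lra. }
  assert (Hex : forall c : C -> R, (forall z w, Rabs (c z - c w) <= Cmod (z - w)) ->
    exists l, is_RInt (fun s => c (propag kappa (t - s) (f s) n)) 0 t l).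
  { intros c Hc.
    assert (E : ex_RInt (V := R_NormedModule) (fun s => c (h s)) 0 t).
    { apply (ex_RInt_continuous (V := R_CompleteNormedModule)). intros x _.
      apply continuous_eps. intros e He. destruct (Hh x e He) as [d [Hd Hy]].
      exists d; split; auto. intros y Hyx. eapply Rle_lt_trans; [apply Hc|apply Hy; auto]. }
    destruct E as [l Hl]. exists l. revert Hl. apply is_RInt_ext.
    rewrite Rmin_left, Rmax_right by lra. intros s Hs. unfold h. rewrite clamp_id by lra.
    reflexivity. }
  destruct (Hex fst) as [l1 H1].
  { intros z w. apply (Rabs_fst_le_Cmod (z - w)%C). }
  destruct (Hex snd) as [l2 H2].
  { intros z w. apply (Rabs_snd_le_Cmod (z - w)%C). }
  exists (l1, l2). split; auto.
Qed.

Definition duhamel_map (kappa gamma : R) (F : R -> R) (q0 : R) (zeta Phi0 : seqZ)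
    (Phi : R -> seqZ) (t : R) (n : Z) : C :=
  (propag kappa t Phi0 n + Ci * @RInt C_R_CompleteNormedModule
    (fun s => propag kappa (t - s) (forcing kappa gamma F q0 zeta (Phi s)) n) 0 t)%C.

(** [RInt] returns a value even when the integral does not exist, so integrability has to accompany
    [duhamel_map] as a separate condition. *)
Definition forcing_integrable kappa gamma F q0 zeta T (Phi : R -> seqZ) : Prop :=
  forall t, 0 <= t <= T -> forall n, @ex_RInt C_R_NormedModule
    (fun s => propag kappa (t - s) (forcing kappa gamma F q0 zeta (Phi s)) n) 0 t.

Lemma duhamel_map_spec kappa gamma F q0 zeta T Phi0 Phi :
  duhamel kappa gamma F q0 zeta T Phi0 Phi <->
  forcing_integrable kappa gamma F q0 zeta T Phi /\
  forall t, 0 <= t <= T -> forall n,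
    Phi t n = duhamel_map kappa gamma F q0 zeta Phi0 Phi t n.
Proof.
  split.
  - intros H. split; intros t Ht n; apply (H t Ht n).
  - intros [H1 H2] t Ht n. split; [apply H1|apply H2]; auto.
Qed.

Lemma l2_cont_forcing kappa gamma q0 K p F zeta Z A d T Phi r :
  background kappa q0 K p F zeta Z A d ->
  l2_cont T Phi -> (forall t, 0 <= t <= T -> l2_le (Phi t) r) ->
  l2_cont T (fun s => forcing kappa gamma F q0 zeta (Phi s)).
Proof.
  intros B Hc Hr t Ht e He.
  set (L := Rabs gamma * (6 * K * Rpower (r + Z + q0) (2 * p))).
  assert (HL : 0 <= L).
  { unfold L, Rpower. pose proof (bg_K _ _ _ _ _ _ _ _ _ B).
    pose proof (exp_pos (2 * p * ln (r + Z + q0))).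
    apply Rmult_le_pos; [apply Rabs_pos|]. apply Rmult_le_pos; lra. }
  destruct (Hc t Ht (e / (L + 1))) as [dl [Hd Hd']].
  { apply Rdiv_lt_0_compat; lra. }
  exists dl. split; auto. intros s Hs Hst.
  apply l2_le_weaken with (L * (e / (L + 1))).
  { apply Rmult_le_reg_r with (L + 1); [lra|]. field_simplify; lra. }
  replace (L * (e / (L + 1)))
    with (Rabs gamma * (6 * K * Rpower (r + Z + q0) (2 * p) * (e / (L + 1))))
    by (generalize (e / (L + 1)); intros x; unfold L; ring).
  eapply forcing_lipschitz; eauto.
Qed.

Lemma l2_cont_integrable kappa gamma q0 K p F zeta Z A d T Phi r :
  background kappa q0 K p F zeta Z A d ->
  l2_cont T Phi -> (forall t, 0 <= t <= T -> l2_le (Phi t) r) ->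
  forcing_integrable kappa gamma F q0 zeta T Phi.
Proof.
  intros B Hc Hr t Ht n. pose proof (bg_kappa _ _ _ _ _ _ _ _ _ B).
  destruct (duhamel_integrable kappa T (fun s => forcing kappa gamma F q0 zeta (Phi s))
    (kappa * (2 * A) + Rabs gamma * (2 * K * Rpower (r + Z + q0) (2 * p) * (r + d))) t n)
    as [l Hl]; auto.
  - lra.
  - eapply l2_cont_forcing; eauto.
  - intros s Hs. eapply forcing_l2; eauto.
  - apply is_CRInt_C_RInt in Hl. apply Hl.
Qed.

(** The integrand is the s-derivative of - propag (t - s) zeta, so the fundamental theorem of
    calculus evaluates the integral in each coordinate, for a merely bounded background. *)
Lemma is_CRInt_linear_forcing kappa zeta Z t n : 0 <= kappa -> 0 <= t -> bdd zeta Z ->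
  is_CRInt (fun s => Ci * RtoC kappa * propag kappa (t - s) (lap zeta) n)%C 0 t
    (propag kappa t zeta n - zeta n)%C.
Proof.
  intros Hk Ht HZ.
  assert (Hd : forall u M s, bdd u M ->
    is_Cderive (fun s => propag kappa (t - s) u n) s
      (- (Ci * RtoC kappa * propag kappa (t - s) (lap u) n))%C).
  { intros u M s Hu. destruct (propag_derive kappa u M (t - s) n Hk Hu) as [H1 H2].
    split; cbn [fst snd Copp].
    - replace (- fst _) with (scal (-1) (fst (Ci * RtoC kappa * propag kappa (t - s) (lap u) n)%C))
        by (unfold scal; simpl; unfold mult; simpl; ring).
      apply (is_derive_comp (fun r => fst (propag kappa r u n)) (fun s => t - s)); auto.
      auto_derive; auto; ring.
    - replace (- snd _) with (scal (-1) (snd (Ci * RtoC kappa * propag kappa (t - s) (lap u) n)%C))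
        by (unfold scal; simpl; unfold mult; simpl; ring).
      apply (is_derive_comp (fun r => snd (propag kappa r u n)) (fun s => t - s)); auto.
      auto_derive; auto; ring. }
  assert (Hl : bdd (lap zeta) (4 * Z)).
  { pose proof (bdd_iter_lap zeta Z 1 HZ) as H. simpl in H. rewrite Rmult_1_r in H. exact H. }
  assert (Hcont : forall c s,
    continuous (fun s => c * fst (propag kappa (t - s) (lap zeta) n)) s /\
    continuous (fun s => c * snd (propag kappa (t - s) (lap zeta) n)) s).
  { intros c s. destruct (Hd (lap zeta) (4 * Z) s Hl) as [H1 H2].
    split; apply (ex_derive_continuous (V := R_NormedModule)); eexists;
      apply is_derive_scal; eassumption. }
  assert (E : (propag kappa t zeta n - zeta n)%C =
    (- propag kappa (t - t) zeta n - - propag kappa (t - 0) zeta n)%C).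
  { rewrite Rminus_diag, Rminus_0_r, propag_0. ring. }
  rewrite E. split.
  - apply (is_RInt_derive (V := R_CompleteNormedModule)
      (fun s => - fst (propag kappa (t - s) zeta n))).
    + intros s _. rewrite <- (Ropp_involutive (fst (Ci * _ * _)%C)).
      apply (is_derive_opp (V := R_NormedModule)), (Hd zeta Z s HZ).
    + intros s _. apply (continuous_ext (fun s => - kappa * snd (propag kappa (t - s) (lap zeta) n))).
      { intros; rewrite fst_Ci_mult; auto. }
      apply (proj2 (Hcont (- kappa) s)).
  - apply (is_RInt_derive (V := R_CompleteNormedModule)
      (fun s => - snd (propag kappa (t - s) zeta n))).
    + intros s _. rewrite <- (Ropp_involutive (snd (Ci * _ * _)%C)).
      apply (is_derive_opp (V := R_NormedModule)), (Hd zeta Z s HZ).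
    + intros s _. apply (continuous_ext (fun s => kappa * fst (propag kappa (t - s) (lap zeta) n))).
      { intros; rewrite snd_Ci_mult; auto. }
      apply (proj1 (Hcont kappa s)).
Qed.

Lemma duhamel_map_bound kappa gamma q0 K p F zeta Z A d T Phi Phi0 M r t :
  background kappa q0 K p F zeta Z A d -> 0 <= t <= T -> l2_le Phi0 M ->
  forcing_integrable kappa gamma F q0 zeta T Phi ->
  (forall s, 0 <= s <= T -> l2_le (Phi s) r) ->
  l2_le (duhamel_map kappa gamma F q0 zeta Phi0 Phi t)
    (M + sqrt (2 * kappa) * A * sqrt t
     + Rabs gamma * (2 * K * Rpower (r + Z + q0) (2 * p) * (r + d)) * t).
Proof.
  intros B Ht HM HI Hr. pose proof (bg_kappa _ _ _ _ _ _ _ _ _ B) as Hk.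
  assert (Hk' : 0 <= kappa) by lra.
  set (N := fun s => nonlin F q0 zeta (Phi s)).
  set (CN := 2 * K * Rpower (r + Z + q0) (2 * p) * (r + d)).
  assert (HN : forall s, 0 <= s <= T -> l2_le (N s) CN)
    by (intros s Hs; eapply nonlin_l2; eauto).
  set (J := fun n => @RInt C_R_CompleteNormedModule
    (fun s => propag kappa (t - s) (forcing kappa gamma F q0 zeta (Phi s)) n) 0 t).
  (* What is left of the Duhamel integral once the exactly integrated linear forcing is removed,
     that is, the integral of the nonlinear part. *)
  set (V := fun n => (Ci * J n - (propag kappa t zeta n - zeta n))%C).
  apply l2_le_ext with (seq_add (seq_add (propag kappa t Phi0)
    (seq_sub (propag kappa t zeta) zeta)) V).
  { intros n. unfold seq_add, seq_sub, V, duhamel_map, J. ring. }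
  apply l2_le_add; [apply l2_le_add|].
  - apply l2_le_propag; auto; lra.
  - apply (propag_sub_id kappa t zeta Z A); auto; try lra; apply B.
  - replace (Rabs gamma * CN * t) with (Rabs gamma * CN * (t - 0)) by ring.
    apply (l2_le_RInt (fun s => seq_scal (Ci * RtoC gamma) (propag kappa (t - s) (N s)))).
    + lra.
    + apply Rmult_le_pos; [apply Rabs_pos|apply (HN t Ht)].
    + intros n. unfold V.
      pose proof (is_CRInt_lin _ _ _ _ Ci (- RtoC 1)%C _ _ (C_RInt_is_CRInt _ _ _ (HI t Ht n))
        (is_CRInt_linear_forcing kappa zeta Z t n Hk' (proj1 Ht) (bg_bdd _ _ _ _ _ _ _ _ _ B))) as L.
      replace (Ci * J n - _)%C with (Ci * J n + - RtoC 1 * (propag kappa t zeta n - zeta n))%C by ring.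
      revert L. apply is_CRInt_ext; [lra|]. intros s Hs.
      unfold forcing. fold (N s).
      rewrite (propag_lin kappa (t - s) (RtoC kappa) (RtoC gamma) (lap zeta) (N s) (2 * A) CN); auto.
      * unfold seq_scal. ring.
      * apply l2_le_bdd, l2_le_lap_bdiff, B.
      * apply l2_le_bdd, HN. lra.
    + intros s Hs. replace (Rabs gamma) with (Cmod (Ci * RtoC gamma)).
      * apply l2_le_scal, l2_le_propag; try lra. apply HN; lra.
      * rewrite Cmod_mult, Cmod_Ci, Cmod_R. ring.
Qed.

(** The linear forcing is common to both images and cancels; the data difference passes through the
    contractive group with factor 1. *)
Lemma duhamel_map_lipschitz kappa gamma q0 K p F zeta Z A d T Phi Psi Phi0 Psi0 delta r D t :
  background kappa q0 K p F zeta Z A d -> 0 <= t <= T ->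
  ell2 Phi0 -> ell2 Psi0 -> l2_le (seq_sub Psi0 Phi0) delta ->
  forcing_integrable kappa gamma F q0 zeta T Phi ->
  forcing_integrable kappa gamma F q0 zeta T Psi ->
  (forall s, 0 <= s <= T -> l2_le (Phi s) r) ->
  (forall s, 0 <= s <= T -> l2_le (Psi s) r) ->
  (forall s, 0 <= s <= T -> l2_le (seq_sub (Psi s) (Phi s)) D) ->
  l2_le (seq_sub (duhamel_map kappa gamma F q0 zeta Psi0 Psi t)
                 (duhamel_map kappa gamma F q0 zeta Phi0 Phi t))
    (delta + Rabs gamma * (6 * K * Rpower (r + Z + q0) (2 * p) * D) * t).
Proof.
  intros B Ht HPhi0 HPsi0 Hdelta HI1 HI2 Hr1 Hr2 HD.
  pose proof (bg_kappa _ _ _ _ _ _ _ _ _ B) as Hk. assert (Hk' : 0 <= kappa) by lra.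
  apply l2_le_norm2 in HPhi0, HPsi0.
  set (Nf := fun (X : R -> seqZ) s => forcing kappa gamma F q0 zeta (X s)).
  set (J := fun X n => @RInt C_R_CompleteNormedModule (fun s => propag kappa (t - s) (Nf X s) n) 0 t).
  set (CF := kappa * (2 * A) + Rabs gamma * (2 * K * Rpower (r + Z + q0) (2 * p) * (r + d))).
  set (CD := Rabs gamma * (6 * K * Rpower (r + Z + q0) (2 * p) * D)).
  assert (HCD : forall s, 0 <= s <= T -> l2_le (seq_sub (Nf Psi s) (Nf Phi s)) CD)
    by (intros s Hs; eapply forcing_lipschitz; eauto).
  apply l2_le_ext with (seq_add (propag kappa t (seq_sub Psi0 Phi0))
    (fun n => Ci * J Psi n + - Ci * J Phi n)%C).
  { intros n. unfold seq_add.
    rewrite (propag_sub kappa t _ _ (norm2 Psi0) (norm2 Phi0)) by auto using l2_le_bdd.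
    unfold seq_sub, duhamel_map, J, Nf. ring. }
  apply l2_le_add; [apply l2_le_propag; auto; lra|].
  replace (CD * t) with (CD * (t - 0)) by ring.
  apply (l2_le_RInt (fun s => seq_scal Ci (propag kappa (t - s) (seq_sub (Nf Psi s) (Nf Phi s))))).
  - lra.
  - apply (HCD t Ht).
  - intros n.
    pose proof (is_CRInt_lin _ _ _ _ Ci (- Ci)%C _ _ (C_RInt_is_CRInt _ _ _ (HI2 t Ht n))
      (C_RInt_is_CRInt _ _ _ (HI1 t Ht n))) as L.
    revert L. apply is_CRInt_ext; [lra|]. intros s Hs.
    unfold seq_scal. rewrite (propag_sub kappa (t - s) _ _ CF CF); auto.
    + unfold Nf. ring.
    + apply l2_le_bdd. eapply forcing_l2; eauto. apply Hr2; lra.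
    + apply l2_le_bdd. eapply forcing_l2; eauto. apply Hr1; lra.
  - intros s Hs. replace CD with (Cmod Ci * CD) by (rewrite Cmod_Ci; ring).
    apply l2_le_scal, l2_le_propag; auto; [lra|]. apply HCD; lra.
Qed.

Lemma l2_le_opp_sub u v M : l2_le (seq_sub u v) M -> l2_le (seq_sub v u) M.
Proof.
  intros H. apply l2_le_dom with (seq_sub u v); auto; [apply H|].
  intros n. unfold seq_sub. rewrite <- Cmod_opp. right; f_equal; ring.
Qed.

Lemma duhamel_map_cont kappa gamma q0 K p F zeta Z A d T Phi Phi0 r :
  background kappa q0 K p F zeta Z A d -> 0 <= T -> ell2 Phi0 ->
  forcing_integrable kappa gamma F q0 zeta T Phi ->
  (forall s, 0 <= s <= T -> l2_le (Phi s) r) ->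
  l2_cont T (duhamel_map kappa gamma F q0 zeta Phi0 Phi).
Proof.
  intros B HT HPhi0 HI Hr. apply l2_le_norm2 in HPhi0. set (M := norm2 Phi0) in *.
  pose proof (bg_kappa _ _ _ _ _ _ _ _ _ B) as Hk. assert (Hk' : 0 <= kappa) by lra.
  set (f := fun s => forcing kappa gamma F q0 zeta (Phi s)).
  set (CF := kappa * (2 * A) + Rabs gamma * (2 * K * Rpower (r + Z + q0) (2 * p) * (r + d))).
  assert (Hf : forall s, 0 <= s <= T -> l2_le (f s) CF)
    by (intros s Hs; eapply forcing_l2; eauto).
  assert (HCF : 0 <= CF) by (apply (Hf 0); lra).
  assert (HM : 0 <= M) by apply HPhi0.
  set (G := duhamel_map kappa gamma F q0 zeta Phi0 Phi).
  (* Three sources of change between t and t': the group acting on the data, the kernel on the old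
     interval [0, t], and the new interval [t, t']. *)
  set (Lp := 4 * kappa * M + 4 * kappa * CF * T + CF).
  assert (HLp : 0 <= Lp).
  { assert (0 <= kappa * M) by (apply Rmult_le_pos; auto).
    assert (0 <= kappa * CF) by (apply Rmult_le_pos; auto).
    assert (0 <= kappa * CF * T) by (apply Rmult_le_pos; auto). unfold Lp; lra. }
  assert (Hmain : forall t t', 0 <= t -> t <= t' -> t' <= T ->
    l2_le (seq_sub (G t') (G t)) (Lp * (t' - t))).
  { intros t t' Ht Htt Ht'.
    set (J1 := fun n => @RInt C_R_CompleteNormedModule (fun s => propag kappa (t' - s) (f s) n) 0 t).
    set (J2 := fun n => @RInt C_R_CompleteNormedModule (fun s => propag kappa (t' - s) (f s) n) t t').
    assert (HJ : forall n, is_CRInt (fun s => propag kappa (t' - s) (f s) n) 0 t (J1 n) /\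
      is_CRInt (fun s => propag kappa (t' - s) (f s) n) t t' (J2 n) /\
      @RInt C_R_CompleteNormedModule (fun s => propag kappa (t' - s) (f s) n) 0 t' = (J1 n + J2 n)%C).
    { intros n. pose proof (C_RInt_is_CRInt _ _ _ (HI t' (conj (Rle_trans _ _ _ Ht Htt) Ht') n)) as H.
      destruct (is_CRInt_split _ 0 t t' _ (conj Ht Htt) H) as (l1 & l2 & H1 & H2 & H3).
      destruct (is_CRInt_C_RInt _ _ _ _ H1) as [_ E1].
      destruct (is_CRInt_C_RInt _ _ _ _ H2) as [_ E2].
      unfold J1, J2, f. rewrite E1, E2. auto. }
    set (J := fun n => @RInt C_R_CompleteNormedModule (fun s => propag kappa (t - s) (f s) n) 0 t).
    (* The summand [RtoC 0 * J2 n] only brings the last term into the two-integral form of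
       [is_CRInt_lin]. *)
    apply l2_le_ext with (seq_add (seq_add (seq_sub (propag kappa t' Phi0) (propag kappa t Phi0))
      (fun n => Ci * J1 n + - Ci * J n)%C) (fun n => Ci * J2 n + RtoC 0 * J2 n)%C).
    { intros n. destruct (HJ n) as (_ & _ & E). unfold seq_add, seq_sub, G, duhamel_map.
      fold (f 0). change (fun s => propag kappa (t' - s) (forcing kappa gamma F q0 zeta (Phi s)) n)
        with (fun s => propag kappa (t' - s) (f s) n).
      rewrite E. unfold J, f. ring. }
    apply l2_le_weaken with (4 * kappa * M * (t' - t) + 4 * kappa * CF * (t' - t) * (t - 0)
      + CF * (t' - t)).
    { assert (4 * kappa * CF * (t' - t) * (t - 0) <= 4 * kappa * CF * (t' - t) * T).
      { apply Rmult_le_compat_l; [|lra]. repeat first [lra | apply Rmult_le_pos]. }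
      unfold Lp. lra. }
    apply l2_le_add; [apply l2_le_add|].
    - rewrite <- (Rabs_pos_eq (t' - t)) by lra. apply propag_lipschitz; auto; lra.
    - apply (l2_le_RInt (fun s => seq_scal Ci (seq_sub (propag kappa (t' - s) (f s))
        (propag kappa (t - s) (f s))))).
      + lra.
      + repeat first [lra | apply Rmult_le_pos].
      + intros n. destruct (HJ n) as (H1 & _ & _).
        pose proof (is_CRInt_lin _ _ _ _ Ci (- Ci)%C _ _ H1
          (C_RInt_is_CRInt _ _ _ (HI t (conj Ht (Rle_trans _ _ _ Htt Ht')) n))) as L.
        revert L. apply is_CRInt_ext; [lra|]. intros s _. unfold seq_scal, seq_sub, f. ring.
      + intros s Hs. replace (4 * kappa * CF * (t' - t)) with
          (Cmod Ci * (4 * kappa * CF * Rabs ((t' - s) - (t - s)))).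
        * apply l2_le_scal, propag_lipschitz; auto; try lra. apply Hf; lra.
        * rewrite Cmod_Ci. replace (t' - s - (t - s)) with (t' - t) by ring.
          rewrite Rabs_pos_eq by lra. ring.
    - apply (l2_le_RInt (fun s => seq_scal Ci (propag kappa (t' - s) (f s)))); auto.
      + intros n. destruct (HJ n) as (_ & H2 & _).
        pose proof (is_CRInt_lin _ _ _ _ Ci (RtoC 0) _ _ H2 H2) as L.
        revert L. apply is_CRInt_ext; [lra|]. intros s _. unfold seq_scal. ring.
      + intros s Hs. replace CF with (Cmod Ci * CF) by (rewrite Cmod_Ci; ring).
        apply l2_le_scal, l2_le_propag; auto; [lra|]. apply Hf; lra. }
  intros t Ht e He. exists (e / (Lp + 1)). split; [apply Rdiv_lt_0_compat; lra|].
  intros s Hs Hst.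
  assert (HLe : Lp * Rabs (s - t) <= e).
  { apply Rle_trans with (Lp * (e / (Lp + 1))); [apply Rmult_le_compat_l; lra|].
    apply Rmult_le_reg_r with (Lp + 1); [lra|]. field_simplify; lra. }
  apply l2_le_weaken with (Lp * Rabs (s - t)); auto.
  destruct (Rle_dec t s) as [Hts|Hts].
  - rewrite Rabs_pos_eq by lra. apply Hmain; lra.
  - rewrite Rabs_left1, Ropp_minus_distr by lra. apply l2_le_opp_sub, Hmain; lra.
Qed.

(** * Fixed point, stability and the theorem *)

Lemma l2_le_closed u a b c : 0 <= a -> 0 <= c < 1 ->
  (forall k, l2_le u (a + b * c ^ k)) -> l2_le u a.
Proof.
  intros Ha Hc H. split; auto. intros N.
  assert (Hl : is_lim_seq (fun k => (a + b * c ^ k) ^ 2) ((a + b * 0) ^ 2)).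
  { assert (Hl1 : is_lim_seq (fun k => a + b * c ^ k) (a + b * 0)).
    { apply is_lim_seq_plus'; [apply is_lim_seq_const|].
      apply is_lim_seq_mult'; [apply is_lim_seq_const|].
      apply is_lim_seq_geom. rewrite Rabs_pos_eq; lra. }
    apply (is_lim_seq_ext (fun k => (a + b * c ^ k) * (a + b * c ^ k))); [intros; ring|].
    replace ((a + b * 0) ^ 2) with ((a + b * 0) * (a + b * 0)) by ring.
    apply is_lim_seq_mult'; auto. }
  replace (a ^ 2) with ((a + b * 0) ^ 2) by (f_equal; ring).
  apply (is_lim_seq_le (fun _ => psum N u u) (fun k => (a + b * c ^ k) ^ 2)
    (Finite (psum N u u)) (Finite ((a + b * 0) ^ 2))); [|apply is_lim_seq_const|exact Hl].
  intros k. apply (H k).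
Qed.

(** An iteration in place of Gronwall: a bound D for the difference improves to delta + 3/4 D.
    Starting from D = 2 r, the bounds come within a geometric error of the fixed point 4 delta. The
    case delta = 0 is uniqueness. *)
Lemma duhamel_stable kappa gamma q0 K p F zeta Z A d T Phi Psi Phi0 Psi0 delta r :
  background kappa q0 K p F zeta Z A d -> 0 <= T ->
  ell2 Phi0 -> ell2 Psi0 -> l2_le (seq_sub Psi0 Phi0) delta ->
  duhamel kappa gamma F q0 zeta T Phi0 Phi ->
  duhamel kappa gamma F q0 zeta T Psi0 Psi ->
  (forall s, 0 <= s <= T -> l2_le (Phi s) r) ->
  (forall s, 0 <= s <= T -> l2_le (Psi s) r) ->
  6 * (Rabs gamma * K * Rpower (r + Z + q0) (2 * p) * T) <= 3 / 4 ->
  forall t, 0 <= t <= T -> l2_le (seq_sub (Psi t) (Phi t)) (4 * delta).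
Proof.
  intros B HT HPhi0 HPsi0 Hdelta DPhi DPsi Hr1 Hr2 Hsmall.
  apply duhamel_map_spec in DPhi, DPsi.
  destruct DPhi as [HI1 E1], DPsi as [HI2 E2].
  pose proof (proj1 Hdelta) as Hd0.
  assert (Hr : 0 <= r) by (apply (Hr1 0); lra).
  set (c := Rabs gamma * (6 * K * Rpower (r + Z + q0) (2 * p))).
  assert (Hc : 0 <= c).
  { unfold c, Rpower. pose proof (bg_K _ _ _ _ _ _ _ _ _ B).
    pose proof (exp_pos (2 * p * ln (r + Z + q0))).
    apply Rmult_le_pos; [apply Rabs_pos|]. apply Rmult_le_pos; lra. }
  assert (Hk : forall k t, 0 <= t <= T ->
    l2_le (seq_sub (Psi t) (Phi t)) (4 * delta + (2 * r) * (3 / 4) ^ k)).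
  { induction k as [|k IH]; intros t Ht.
    - apply l2_le_weaken with (r + r); [simpl; lra|]. apply l2_le_sub; auto.
    - set (D := 4 * delta + 2 * r * (3 / 4) ^ k) in *.
      assert (HD : 0 <= D) by apply (IH t Ht).
      apply l2_le_weaken with (delta + Rabs gamma * (6 * K * Rpower (r + Z + q0) (2 * p) * D) * t).
      + replace (4 * delta + 2 * r * (3 / 4) ^ S k) with (delta + 3 / 4 * D)
          by (unfold D; simpl; field).
        apply Rplus_le_compat_l.
        replace (Rabs gamma * (6 * K * Rpower (r + Z + q0) (2 * p) * D) * t) with (c * t * D)
          by (unfold c; ring).
        apply Rmult_le_compat_r; auto.
        apply Rle_trans with (c * T); [apply Rmult_le_compat_l; lra|unfold c; lra].
      + eapply l2_le_ext; [|eapply (duhamel_map_lipschitz kappa gamma q0 K p F zeta Z A d T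
          Phi Psi Phi0 Psi0 delta r D t); eauto].
        intros n. unfold seq_sub. rewrite E1, E2; auto. }
  intros t Ht. apply (l2_le_closed _ (4 * delta) (2 * r) (3 / 4)); auto; lra.
Qed.

Lemma geometric_ex_lim (x : nat -> R) C0 :
  (forall k m, (k <= m)%nat -> Rabs (x m - x k) <= C0 * (1 / 2) ^ k) ->
  is_lim_seq x (real (Lim_seq x)).
Proof.
  intros H. apply Lim_seq_correct'. apply ex_lim_seq_cauchy_corr. intros e.
  assert (Hl : is_lim_seq (fun k => C0 * (1 / 2) ^ k) (C0 * 0)).
  { apply is_lim_seq_mult'; [apply is_lim_seq_const|]. apply is_lim_seq_geom.
    rewrite Rabs_pos_eq; lra. }
  rewrite Rmult_0_r in Hl. apply is_lim_seq_spec in Hl.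
  destruct (Hl (pos_div_2 e)) as [N HN]. exists N. intros n m Hn Hm.
  pose proof (H N n Hn). pose proof (H N m Hm). specialize (HN N (le_n _)).
  rewrite Rminus_0_r in HN. simpl in HN. apply Rabs_lt_between in HN.
  replace (x n - x m) with ((x n - x N) - (x m - x N)) by ring.
  eapply Rle_lt_trans; [apply Rabs_triang|]. rewrite Rabs_Ropp. lra.
Qed.

Lemma l2_le_0_eq u v : l2_le (seq_sub u v) 0 -> forall n, u n = v n.
Proof.
  intros H n. pose proof (l2_le_Cmod _ _ n H) as Hn.
  assert (E : seq_sub u v n = RtoC 0).
  { apply Cmod_eq_0. pose proof (Cmod_ge_0 (seq_sub u v n)). lra. }
  unfold seq_sub in E. replace (u n) with ((u n - v n) + v n)%C by ring. rewrite E. ring.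
Qed.

Lemma l2_le_sub_trans u v w a b : l2_le (seq_sub u v) a -> l2_le (seq_sub v w) b ->
  l2_le (seq_sub u w) (a + b).
Proof.
  intros Ha Hb. eapply l2_le_ext; [|apply (l2_le_add _ _ _ _ Ha Hb)].
  intros n. unfold seq_add, seq_sub. ring.
Qed.

(** The limit of the Picard iterates is taken coordinate by coordinate; [l2_le_ptlim] then upgrades
    it to l2 convergence, uniform in time. *)
Lemma picard_exists kappa gamma q0 K p F zeta Z A d T Phi0 r :
  background kappa q0 K p F zeta Z A d -> 0 <= T -> ell2 Phi0 ->
  6 * (Rabs gamma * K * Rpower (r + Z + q0) (2 * p) * T) <= 1 / 2 ->
  norm2 Phi0 + sqrt (2 * kappa) * A * sqrt T
    + Rabs gamma * (2 * K * Rpower (r + Z + q0) (2 * p) * (r + d)) * T <= r ->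
  0 <= r ->
  exists Phi, l2_cont T Phi /\ (forall t, 0 <= t <= T -> l2_le (Phi t) r) /\
    duhamel kappa gamma F q0 zeta T Phi0 Phi.
Proof.
  intros B HT HPhi0 Hsmall Hball Hr.
  set (G := duhamel_map kappa gamma F q0 zeta Phi0).
  set (in_ball := fun X : R -> seqZ => l2_cont T X /\ (forall t, 0 <= t <= T -> l2_le (X t) r)).
  assert (Hint : forall X, in_ball X -> forcing_integrable kappa gamma F q0 zeta T X).
  { intros X [H1 H2]. eapply l2_cont_integrable; eauto. }
  assert (HP : 0 < Rpower (r + Z + q0) (2 * p)) by apply exp_pos.
  pose proof (bg_K _ _ _ _ _ _ _ _ _ B) as HK. pose proof (Rabs_pos gamma) as Hgam.
  assert (HG : forall X, in_ball X -> in_ball (G X)).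
  { intros X HX. split.
    - eapply duhamel_map_cont; eauto. apply HX.
    - intros t Ht. eapply l2_le_weaken;
        [|eapply duhamel_map_bound; eauto; [apply l2_le_norm2; auto|apply HX]].
      pose proof (proj1 (bg_diff _ _ _ _ _ _ _ _ _ B)) as HA.
      pose proof (proj1 (bg_def _ _ _ _ _ _ _ _ _ B)) as Hd.
      eapply Rle_trans; [|apply Hball]. apply Rplus_le_compat.
      + apply Rplus_le_compat_l. apply Rmult_le_compat_l.
        * apply Rmult_le_pos; auto. apply sqrt_pos.
        * apply sqrt_le_1_alt; lra.
      + apply Rmult_le_compat_l; [|lra].
        repeat first [lra | apply Rmult_le_pos]. }
  assert (Hcontr : forall X Y D, in_ball X -> in_ball Y ->
    (forall t, 0 <= t <= T -> l2_le (seq_sub (Y t) (X t)) D) ->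
    forall t, 0 <= t <= T -> l2_le (seq_sub (G Y t) (G X t)) (D * (1 / 2))).
  { intros X Y D HX HY HD t Ht.
    assert (HD0 : 0 <= D) by apply (HD t Ht).
    eapply l2_le_weaken; [|eapply (duhamel_map_lipschitz kappa gamma q0 K p F zeta Z A d T
      X Y Phi0 Phi0 0 r D t); eauto; [|apply HX|apply HY]].
    - rewrite Rplus_0_l.
      apply Rle_trans with (D * (6 * (Rabs gamma * K * Rpower (r + Z + q0) (2 * p) * T))).
      + replace (Rabs gamma * (6 * K * Rpower (r + Z + q0) (2 * p) * D) * t)
          with (D * (6 * (Rabs gamma * K * Rpower (r + Z + q0) (2 * p) * t))) by ring.
        apply Rmult_le_compat_l; auto. apply Rmult_le_compat_l; [lra|].
        apply Rmult_le_compat_l; [|lra]. repeat first [lra | apply Rmult_le_pos].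
      + apply Rmult_le_compat_l; auto.
    - eapply l2_le_ext; [|apply l2_le_zero]. intros n; unfold seq_sub; ring. }
  set (X := fun k => Nat.iter k G (fun _ _ => RtoC 0)).
  assert (HX : forall k, in_ball (X k)).
  { induction k as [|k IH]; [|apply HG, IH]. unfold X; simpl. split.
    - intros t Ht e He. exists 1; split; [lra|]. intros s _ _.
      apply l2_le_weaken with 0; [lra|]. eapply l2_le_ext; [|apply l2_le_zero].
      intros n; unfold seq_sub; ring.
    - intros t _. apply l2_le_weaken with 0; [lra|]. apply l2_le_zero. }
  assert (Hstep : forall k t, 0 <= t <= T -> l2_le (seq_sub (X (S k) t) (X k t)) (r * (1 / 2) ^ k)).
  { induction k as [|k IH]; intros t Ht.
    - simpl. rewrite Rmult_1_r. eapply l2_le_ext; [|apply (proj2 (HX 1%nat) t Ht)].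
      intros n. unfold seq_sub, X; simpl. ring.
    - replace (r * (1 / 2) ^ S k) with (r * (1 / 2) ^ k * (1 / 2)) by (simpl; ring).
      apply (Hcontr (X k) (X (S k))); auto. }
  assert (Hpow : forall k, 0 < (1 / 2) ^ k) by (intros k; apply pow_lt; lra).
  (* The exact geometric sum is kept, because the rounded bound 2 r (1/2)^k would not survive the
     induction on [j]. *)
  assert (Hcauchy : forall k j t, 0 <= t <= T ->
    l2_le (seq_sub (X (k + j)%nat t) (X k t)) (2 * r * ((1 / 2) ^ k - (1 / 2) ^ (k + j)))).
  { intros k j t Ht. induction j as [|j IH].
    - rewrite Nat.add_0_r, Rminus_diag, Rmult_0_r. eapply l2_le_ext; [|apply l2_le_zero].
      intros n; unfold seq_sub; ring.
    - replace (2 * r * ((1 / 2) ^ k - (1 / 2) ^ (k + S j)))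
        with (r * (1 / 2) ^ (k + j) + 2 * r * ((1 / 2) ^ k - (1 / 2) ^ (k + j)))
        by (rewrite Nat.add_succ_r; simpl; field).
      rewrite Nat.add_succ_r. apply l2_le_sub_trans with (X (k + j)%nat t); auto. }
  assert (Hcauchy' : forall k m t, (k <= m)%nat -> 0 <= t <= T ->
    l2_le (seq_sub (X m t) (X k t)) (2 * r * (1 / 2) ^ k)).
  { intros k m t Hkm Ht. replace m with (k + (m - k))%nat by lia.
    eapply l2_le_weaken; [|apply Hcauchy; auto].
    apply Rmult_le_compat_l; [lra|]. pose proof (Hpow (k + (m - k))%nat). lra. }
  set (Phi := fun t n => (real (Lim_seq (fun k => fst (X k t n))),
                          real (Lim_seq (fun k => snd (X k t n)))) : C).
  assert (Hlim : forall t, 0 <= t <= T -> ptlim (fun k => X k t) (Phi t)).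
  { intros t Ht n. split; apply (geometric_ex_lim _ (2 * r)); intros k m Hkm;
      (eapply Rle_trans; [|apply (l2_le_Cmod _ _ n (Hcauchy' k m t Hkm Ht))]).
    - apply (Rabs_fst_le_Cmod (X m t n - X k t n)%C).
    - apply (Rabs_snd_le_Cmod (X m t n - X k t n)%C). }
  assert (HPhir : forall t, 0 <= t <= T -> l2_le (Phi t) r).
  { intros t Ht. apply (l2_le_ptlim (fun k => X k t) _ _ 0); auto.
    intros j _. apply HX; auto. }
  (* Let m tend to infinity in [Hcauchy'] with k fixed; the bound holds from m = k on and does not
     depend on t. *)
  assert (Hdist : forall k t, 0 <= t <= T -> l2_le (seq_sub (Phi t) (X k t)) (2 * r * (1 / 2) ^ k)).
  { intros k t Ht. apply (l2_le_ptlim (fun m => seq_sub (X m t) (X k t)) _ _ k); auto.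
    intros n. destruct (Hlim t Ht n) as [H1 H2]. split; unfold seq_sub; simpl.
    - apply is_lim_seq_plus'; auto. apply is_lim_seq_const.
    - apply is_lim_seq_plus'; auto. apply is_lim_seq_const. }
  assert (HPhic : l2_cont T Phi).
  { intros t Ht e He.
    assert (Hl : is_lim_seq (fun k => 2 * r * (1 / 2) ^ k) (2 * r * 0)).
    { apply is_lim_seq_mult'; [apply is_lim_seq_const|]. apply is_lim_seq_geom.
      rewrite Rabs_pos_eq; lra. }
    rewrite Rmult_0_r in Hl. apply is_lim_seq_spec in Hl.
    destruct (Hl (mkposreal (e / 3) ltac:(lra))) as [k Hk].
    specialize (Hk k (le_n _)). rewrite Rminus_0_r in Hk. simpl in Hk.
    apply Rabs_lt_between in Hk.
    destruct (proj1 (HX k) t Ht (e / 3) ltac:(lra)) as [dl [Hd Hd']].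
    exists dl; split; auto. intros s Hs Hst.
    apply l2_le_weaken with (2 * r * (1 / 2) ^ k + e / 3 + 2 * r * (1 / 2) ^ k); [lra|].
    apply l2_le_sub_trans with (X k t); [apply l2_le_sub_trans with (X k s)|].
    - apply Hdist; auto.
    - apply Hd'; auto.
    - apply l2_le_opp_sub, Hdist; auto. }
  exists Phi. split; [auto|]. split; [auto|].
  apply duhamel_map_spec. split; [apply Hint; split; auto|].
  (* Both Phi and its image are compared with X (k+1), the image of X k: the distances 2 r
     (1/2)^(k+1) and half of 2 r (1/2)^k tend to 0. *)
  intros t Ht. apply l2_le_0_eq.
  apply (l2_le_closed _ 0 (2 * r) (1 / 2)); [lra|lra|]. intros k.
  replace (0 + 2 * r * (1 / 2) ^ k)
    with (2 * r * (1 / 2) ^ (S k) + 2 * r * (1 / 2) ^ k * (1 / 2)) by (simpl; field).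
  apply l2_le_sub_trans with (X (S k) t); [apply Hdist; auto|].
  apply l2_le_opp_sub. apply (Hcontr (X k) Phi); auto. split; auto.
Qed.

(** * Translation to the norms, limits and balls of the statement *)

Lemma CT_ell2_l2_cont T Phi : CT_ell2 T Phi <->
  (forall t, 0 <= t <= T -> ell2 (Phi t)) /\ l2_cont T Phi.
Proof.
  split; intros [H1 H2]; split; auto; intros t Ht.
  - intros e He.
    pose proof (proj1 (filterlim_locally _ _) (H2 t Ht) (mkposreal e He)) as [dl Hd].
    exists dl; split; [apply cond_pos|]. intros s Hs Hst.
    specialize (Hd s Hst Hs). unfold ball in Hd; simpl in Hd.
    unfold AbsRing_ball, abs, minus, plus, opp in Hd; simpl in Hd.
    rewrite Ropp_0, Rplus_0_r in Hd. apply Rabs_lt_between in Hd.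
    apply l2_le_weaken with (norm2 (seq_sub (Phi s) (Phi t))); [lra|].
    apply l2_le_norm2.
    apply (l2_le_ell2 _ (norm2 (Phi s) + norm2 (Phi t))).
    apply l2_le_sub; apply l2_le_norm2; auto.
  - apply filterlim_locally. intros e.
    destruct (H2 t Ht (e / 2)) as [dl [Hd Hd']]; [pose proof (cond_pos e); lra|].
    exists (mkposreal dl Hd). intros s Hst Hs.
    destruct (l2_le_ell2 _ _ (Hd' s Hs Hst)) as [_ Hn].
    unfold ball; simpl. unfold AbsRing_ball, abs, minus, plus, opp; simpl.
    rewrite Ropp_0, Rplus_0_r, Rabs_pos_eq by apply sqrt_pos.
    pose proof (cond_pos e). lra.
Qed.

Lemma normCT_le T Phi r :
  Rbar_le (normCT T Phi) (Finite r) <-> forall t, 0 <= t <= T -> norm2 (Phi t) <= r.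
Proof.
  unfold normCT. set (E := fun x => exists t, 0 <= t <= T /\ x = norm2 (Phi t)).
  destruct (Lub_Rbar_correct E) as [H1 H2]. split.
  - intros H t Ht.
    apply (Rbar_le_trans (norm2 (Phi t)) (Lub_Rbar E) r); auto.
    apply H1. exists t; auto.
  - intros H. apply H2. intros x [t [Ht ->]]. apply H; auto.
Qed.

Lemma ellinf_bdd u : ellinf u -> bdd u (norminf u).
Proof.
  intros [M HM] n. unfold norminf.
  set (E := fun x => exists n, x = Cmod (u n)).
  destruct (Lub_Rbar_correct E) as [H1 H2].
  assert (Hn : Rbar_le (Cmod (u n)) (Lub_Rbar E)) by (apply H1; exists n; auto).
  assert (HM' : Rbar_le (Lub_Rbar E) M) by (apply H2; intros x [m ->]; apply HM).
  destruct (Lub_Rbar E); simpl in *; auto; contradiction.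
Qed.

Lemma filterlim_C_0 (x : nat -> C) :
  (forall e, 0 < e -> exists N, forall k, (N <= k)%nat -> Cmod (x k) < e) ->
  filterlim x eventually (locally (RtoC 0)).
Proof.
  intros H. apply filterlim_locally. intros e.
  destruct (H e (cond_pos e)) as [N HN]. exists N. intros k Hk. specialize (HN k Hk).
  split; unfold ball; simpl; unfold AbsRing_ball, abs, minus, plus, opp; simpl;
    rewrite Ropp_0, Rplus_0_r; eapply Rle_lt_trans; try apply HN.
  - apply Rabs_fst_le_Cmod.
  - apply Rabs_snd_le_Cmod.
Qed.

Lemma ell2_lim u : ell2 u -> lim_pinf u (RtoC 0) /\ lim_minf u (RtoC 0).
Proof.
  intros H. apply l2_le_norm2 in H. split; apply filterlim_C_0; intros e He;
    destruct (l2_le_zero_Cmod u _ H e He) as [N HN].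
  - exists N. intros k Hk. apply HN; auto.
  (* The limit at minus infinity runs over -k, while [l2_le_zero_Cmod] speaks of -(k+1); hence the
     shift by one. *)
  - exists (S N). intros [|k] Hk; [lia|]. apply HN; lia.
Qed.

Lemma norm2_nonneg u : 0 <= norm2 u.
Proof. apply sqrt_pos. Qed.

Lemma duhamel_0 kappa gamma F q0 zeta T Phi0 Phi n : 0 <= T ->
  duhamel kappa gamma F q0 zeta T Phi0 Phi -> Phi 0 n = Phi0 n.
Proof.
  intros HT H. destruct (H 0 ltac:(lra) n) as [_ ->]. rewrite propag_0.
  rewrite (RInt_point (V := C_R_CompleteNormedModule)).
  change (@zero C_R_CompleteNormedModule) with (RtoC 0). ring.
Qed.

Lemma solution_in_ball_intro kappa gamma K p F q0 zeta T Phi0 Phi :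
  0 <= T -> l2_cont T Phi ->
  (forall t, 0 <= t <= T -> l2_le (Phi t) (rho kappa gamma K p q0 zeta Phi0 T)) ->
  duhamel kappa gamma F q0 zeta T Phi0 Phi ->
  solution_in_ball kappa gamma K p F q0 zeta T Phi0 Phi.
Proof.
  intros HT Hc Hr HD.
  assert (Hell : forall t, 0 <= t <= T -> ell2 (Phi t)).
  { intros t Ht. eapply l2_le_ell2; eauto. }
  assert (HCT : CT_ell2 T Phi) by (apply CT_ell2_l2_cont; auto).
  split; split; auto.
  - split; [auto|]. split.
    + intros n; eapply duhamel_0; eauto.
    + intros t Ht. apply ell2_lim; auto.
  - apply normCT_le. intros t Ht. apply (l2_le_ell2 _ _ (Hr t Ht)).
Qed.

Lemma solution_in_ball_elim kappa gamma K p F q0 zeta T Phi0 Phi :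
  solution_in_ball kappa gamma K p F q0 zeta T Phi0 Phi ->
  duhamel kappa gamma F q0 zeta T Phi0 Phi /\
  forall t, 0 <= t <= T -> l2_le (Phi t) (rho kappa gamma K p q0 zeta Phi0 T).
Proof.
  intros [(HC & HD & _) [_ Hn]]. split; auto. intros t Ht.
  rewrite normCT_le in Hn. apply l2_le_weaken with (norm2 (Phi t)); auto.
  apply l2_le_norm2, (proj1 HC t Ht).
Qed.

(** * Arithmetic of the radius and the lifespan *)

Lemma Rpower_2_ge x n : INR n <= x -> 2 ^ n <= Rpower 2 x.
Proof.
  intros H. rewrite <- Rpower_pow by lra. apply Rle_Rpower; lra.
Qed.

Lemma rho_nonneg kappa gamma K p q0 zeta Phi0 T : 0 <= K -> 0 <= T ->
  0 <= rho kappa gamma K p q0 zeta Phi0 T.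
Proof.
  intros HK HT. unfold rho.
  pose proof (norm2_nonneg Phi0). pose proof (norm2_nonneg (bdiff zeta)).
  pose proof (sqrt_pos (2 * kappa)). pose proof (sqrt_pos T). pose proof (Rabs_pos gamma).
  assert (0 <= sqrt (2 * kappa) * norm2 (bdiff zeta) * sqrt T)
    by (repeat first [assumption | apply Rmult_le_pos]).
  assert (0 <= Rpower 2 (2 * p + 3 / 2) * Rabs gamma * K
    * Rpower (norminf zeta + norm2 (mod_defect q0 zeta) + q0) (2 * p + 1) * T).
  { unfold Rpower. repeat first [assumption | left; apply exp_pos | apply Rmult_le_pos]. }
  lra.
Qed.

Lemma lifespan_exists kappa gamma K p q0 zeta Phi0 :
  0 < kappa -> 0 < q0 -> 0 < K -> 1 <= p -> 0 <= norminf zeta ->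
  exists T, 0 < T /\ lifespan_cond kappa gamma K p q0 zeta Phi0 T.
Proof.
  intros Hkappa Hq0 HK Hp HZ.
  set (S1 := rho kappa gamma K p q0 zeta Phi0 1 + norminf zeta + q0).
  set (c := Rpower 2 (2 * p + 5 / 2) * Rabs gamma * K).
  assert (Hc : 0 <= c).
  { unfold c, Rpower. pose proof (Rabs_pos gamma).
    repeat first [lra | left; apply exp_pos | apply Rmult_le_pos]. }
  assert (HP : 0 < Rpower S1 (2 * p)) by apply exp_pos.
  assert (HcP : 0 <= c * Rpower S1 (2 * p)) by (apply Rmult_le_pos; lra).
  (* This choice forces T <= 1, so rho(T) <= rho(1) and the implicit condition follows from the
     explicit one with [S1]; the added 1 covers gamma = 0. *)
  set (T := / (c * Rpower S1 (2 * p) + 1)).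
  assert (HT : 0 < T) by (apply Rinv_0_lt_compat; lra).
  assert (HT1 : T <= 1).
  { unfold T. rewrite <- Rinv_1. apply Rinv_le_contravar; lra. }
  exists T; split; auto. unfold lifespan_cond. fold c.
  assert (Hrho : rho kappa gamma K p q0 zeta Phi0 T <= rho kappa gamma K p q0 zeta Phi0 1).
  { unfold rho. apply Rmult_le_compat_l; [lra|].
    pose proof (norm2_nonneg (bdiff zeta)). pose proof (Rabs_pos gamma).
    apply Rplus_le_compat; [apply Rplus_le_compat_l|]; apply Rmult_le_compat_l; auto.
    - apply Rmult_le_pos; auto. apply sqrt_pos.
    - apply sqrt_le_1_alt; auto.
    - unfold Rpower. repeat first [lra | left; apply exp_pos | apply Rmult_le_pos]. }
  assert (HR : 0 <= rho kappa gamma K p q0 zeta Phi0 T) by (apply rho_nonneg; lra).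
  apply Rle_trans with (c * Rpower S1 (2 * p) * T).
  - apply Rmult_le_compat_r; [lra|]. apply Rmult_le_compat_l; auto.
    apply Rle_Rpower_l; unfold S1; lra.
  - unfold T. apply Rmult_le_reg_r with (c * Rpower S1 (2 * p) + 1); [lra|].
    rewrite Rmult_assoc, Rinv_l by lra. lra.
Qed.

Lemma lifespan_small kappa gamma K p q0 zeta Phi0 T : 0 <= K -> 0 <= T -> 1 <= p ->
  lifespan_cond kappa gamma K p q0 zeta Phi0 T ->
  0 <= Rabs gamma * K
    * Rpower (rho kappa gamma K p q0 zeta Phi0 T + norminf zeta + q0) (2 * p) * T <= 1 / 16.
Proof.
  intros HK HT Hp H. unfold lifespan_cond in H.
  set (P := Rpower (rho kappa gamma K p q0 zeta Phi0 T + norminf zeta + q0) (2 * p)) in *.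
  assert (HP : 0 < P) by apply exp_pos. pose proof (Rabs_pos gamma) as Hg.
  assert (HX : 0 <= Rabs gamma * K * P * T)
    by (repeat first [lra | apply Rmult_le_pos]).
  split; auto.
  (* Since p >= 1, the exponent 2p + 5/2 is at least 9/2; the integer 4 is enough. *)
  assert (H16 : 2 ^ 4 <= Rpower 2 (2 * p + 5 / 2)) by (apply Rpower_2_ge; simpl; lra).
  assert (2 ^ 4 * (Rabs gamma * K * P * T) <= Rpower 2 (2 * p + 5 / 2) * (Rabs gamma * K * P * T))
    by (apply Rmult_le_compat_r; auto).
  lra.
Qed.

Lemma lifespan_ball kappa gamma K p q0 zeta Phi0 T : 0 <= K -> 0 <= T -> 1 <= p -> 0 < q0 ->
  0 <= norminf zeta ->
  lifespan_cond kappa gamma K p q0 zeta Phi0 T ->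
  let r := rho kappa gamma K p q0 zeta Phi0 T in
  norm2 Phi0 + sqrt (2 * kappa) * norm2 (bdiff zeta) * sqrt T
    + Rabs gamma * (2 * K * Rpower (r + norminf zeta + q0) (2 * p)
      * (r + norm2 (mod_defect q0 zeta))) * T <= r.
Proof.
  intros HK HT Hp Hq HZ H r.
  destruct (lifespan_small kappa gamma K p q0 zeta Phi0 T HK HT Hp H) as [HX0 HX].
  pose proof (rho_nonneg kappa gamma K p q0 zeta Phi0 T HK HT) as Hr. fold r in HX0, HX, Hr.
  set (S := r + norminf zeta + q0) in *. set (d := norm2 (mod_defect q0 zeta)).
  assert (Hd : 0 <= d) by apply norm2_nonneg.
  set (X := Rabs gamma * K * Rpower S (2 * p) * T) in *.
  set (W := norminf zeta + d + q0).
  set (Q := Rpower 2 (2 * p + 3 / 2) * Rabs gamma * K * Rpower W (2 * p + 1) * T).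
  set (M := norm2 Phi0 + sqrt (2 * kappa) * norm2 (bdiff zeta) * sqrt T).
  assert (Hrdef : r = 2 * (M + Q)) by reflexivity.
  replace (Rabs gamma * (2 * K * Rpower S (2 * p) * (r + d)) * T) with (2 * X * r + 2 * X * d)
    by (unfold X; ring).
  pose proof (Rabs_pos gamma) as Hg.
  assert (HQ : 0 <= Q).
  { unfold Q, Rpower. repeat first [lra | left; apply exp_pos | apply Rmult_le_pos]. }
  (* With r = 2 (M + Q) and X <= 1/16 this closes the ball: M + Q + 4 X r <= r/2 + r/4. If d <= r
     the defect is absorbed by the radius; if d > r then S <= W, and [Q] dominates. *)
  assert (Hkey : 2 * X * d <= Q + 2 * X * r).
  { destruct (Rle_dec d r) as [Hdr|Hdr].
    - assert (X * d <= X * r) by (apply Rmult_le_compat_l; auto). lra.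
    - assert (HXr : 0 <= X * r) by (apply Rmult_le_pos; auto).
      assert (Q >= 2 * X * d); [|lra]. apply Rle_ge.
      assert (HW : 0 < W) by (unfold W; lra).
      assert (E1 : Rpower S (2 * p) * d <= Rpower W (2 * p + 1)).
      { rewrite Rpower_plus, Rpower_1 by auto. apply Rmult_le_compat; auto.
        - left; apply exp_pos.
        - apply Rle_Rpower_l; unfold S, W; lra.
        - unfold W; lra. }
      assert (E2 : 2 ^ 1 <= Rpower 2 (2 * p + 3 / 2)) by (apply Rpower_2_ge; simpl; lra).
      replace (2 * X * d) with (2 ^ 1 * (Rpower S (2 * p) * d) * (Rabs gamma * K * T))
        by (unfold X; ring).
      replace Q with (Rpower 2 (2 * p + 3 / 2) * Rpower W (2 * p + 1) * (Rabs gamma * K * T))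
        by (unfold Q; ring).
      apply Rmult_le_compat_r; [repeat first [lra | apply Rmult_le_pos]|].
      apply Rmult_le_compat; auto; [lra|].
      apply Rmult_le_pos; auto. left; apply exp_pos. }
  assert (X * r <= 1 / 16 * r) by (apply Rmult_le_compat_r; auto).
  fold M. lra.
Qed.

Theorem theorem2p1 :
  forall (kappa gamma q0 K p : R) (F : R -> R) (zeta : seqZ) (zm zp : C),
  0 < kappa -> 0 < q0 -> 0 < K -> 1 <= p ->
  F_hyp F K p ->
  X1 zeta ->
  lim_minf zeta zm -> lim_pinf zeta zp -> Cmod zm = q0 -> Cmod zp = q0 ->
  ell2 (mod_defect q0 zeta) ->
  forall Phi0 : seqZ, ell2 Phi0 ->
  (exists T, 0 < T /\ lifespan_cond kappa gamma K p q0 zeta Phi0 T) /\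
  (forall T, 0 < T -> lifespan_cond kappa gamma K p q0 zeta Phi0 T ->
   exists Phi : R -> seqZ,
     solution_in_ball kappa gamma K p F q0 zeta T Phi0 Phi /\
     (forall Psi : R -> seqZ,
        solution_in_ball kappa gamma K p F q0 zeta T Phi0 Psi ->
        forall t, 0 <= t <= T -> forall n, Psi t n = Phi t n) /\
     (forall eps, 0 < eps -> exists delta, 0 < delta /\
        forall (Psi0 : seqZ) (Psi : R -> seqZ),
          ell2 Psi0 -> norm2 (seq_sub Psi0 Phi0) < delta ->
          solution_in_ball kappa gamma K p F q0 zeta T Psi0 Psi ->
          Rbar_lt (normCT T (fun t => seq_sub (Psi t) (Phi t))) (Finite eps))).
Proof.
  intros kappa gamma q0 K p F zeta zm zp Hkappa Hq0 HK Hp HF [Hinf Hdiff] _ _ _ _ Hdef Phi0 HPhi0.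
  apply ellinf_bdd in Hinf. apply l2_le_norm2 in Hdiff, Hdef.
  assert (B : background kappa q0 K p F zeta (norminf zeta) (norm2 (bdiff zeta))
    (norm2 (mod_defect q0 zeta))) by (split; auto).
  pose proof (bg_Z _ _ _ _ _ _ _ _ _ B) as HZ.
  split; [apply lifespan_exists; auto|].
  intros T HT Hlife.
  assert (HT0 : 0 <= T) by lra. assert (HK0 : 0 <= K) by lra.
  pose proof (lifespan_small _ _ _ _ _ _ _ _ HK0 HT0 Hp Hlife) as [HX0 HX].
  pose proof (lifespan_ball _ _ _ _ _ _ _ _ HK0 HT0 Hp Hq0 HZ Hlife) as Hball.
  pose proof (rho_nonneg kappa gamma K p q0 zeta Phi0 T HK0 HT0) as Hr0. cbv zeta in Hball.
  set (r := rho kappa gamma K p q0 zeta Phi0 T) in *.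
  set (S := r + norminf zeta + q0) in *. assert (HS : 0 < S) by (unfold S; lra).
  destruct (picard_exists kappa gamma q0 K p F zeta (norminf zeta) (norm2 (bdiff zeta))
    (norm2 (mod_defect q0 zeta)) T Phi0 r) as (Phi & Hc & Hr & HD); auto.
  { fold S. lra. }
  assert (Hsol : solution_in_ball kappa gamma K p F q0 zeta T Phi0 Phi)
    by (apply solution_in_ball_intro; auto).
  exists Phi. split; [|split]; auto.
  - intros Psi HPsi t Ht.
    apply solution_in_ball_elim in HPsi. destruct HPsi as [HD' Hr'].
    (* Uniqueness is stability with equal data; here both solutions lie in the same ball. *)
    apply l2_le_0_eq. replace 0 with (4 * 0) by ring.
    apply (duhamel_stable kappa gamma q0 K p F zeta (norminf zeta) (norm2 (bdiff zeta))
      (norm2 (mod_defect q0 zeta)) T Phi Psi Phi0 Phi0 0 r); auto.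
    + eapply l2_le_ext; [|apply l2_le_zero]. intros n; unfold seq_sub; ring.
    + fold S. lra.
  - intros eps Heps.
    (* With initial data closer than [eta * S / 2] the ball radius grows by at most
       [eta * S], which doubles [S ^ (2 p)]; the Lipschitz constant stays below 3/4. *)
    set (eta := Rpower 2 (1 / (2 * p)) - 1).
    assert (Heta : 0 < eta).
    { unfold eta. rewrite <- (Rpower_O 2) at 2 by lra.
      assert (Rpower 2 0 < Rpower 2 (1 / (2 * p))); [|lra].
      apply Rpower_lt; [lra|]. apply Rdiv_lt_0_compat; lra. }
    assert (HetaS : 0 < eta * S) by (apply Rmult_lt_0_compat; auto).
    (* The factor 2 in [rho] turns eta S / 2 into a growth eta S of the radius; the stability factor
       4 turns eps / 8 into eps / 2, which leaves the strict inequality for the supremum. *)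
    exists (Rmin (eta * S / 2) (eps / 8)). split; [apply Rmin_pos; lra|].
    intros Psi0 Psi HPsi0 Hclose HPsi.
    assert (Hclose1 : norm2 (seq_sub Psi0 Phi0) < eta * S / 2)
      by (eapply Rlt_le_trans; [apply Hclose|apply Rmin_l]).
    assert (Hclose2 : norm2 (seq_sub Psi0 Phi0) < eps / 8)
      by (eapply Rlt_le_trans; [apply Hclose|apply Rmin_r]).
    set (dl := norm2 (seq_sub Psi0 Phi0)) in *.
    assert (Hdl : l2_le (seq_sub Psi0 Phi0) dl).
    { apply l2_le_norm2. apply (l2_le_ell2 _ (norm2 Psi0 + norm2 Phi0)).
      apply l2_le_sub; apply l2_le_norm2; auto. }
    assert (HPsin : norm2 Psi0 <= norm2 Phi0 + dl).
    { apply (l2_le_ell2 Psi0 (norm2 Phi0 + dl)).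
      eapply l2_le_ext; [|apply (l2_le_add _ _ _ _ (l2_le_norm2 _ HPhi0) Hdl)].
      intros n; unfold seq_add, seq_sub; ring. }
    apply solution_in_ball_elim in HPsi. destruct HPsi as [HD' Hr'].
    assert (Hrho : rho kappa gamma K p q0 zeta Psi0 T <= r + eta * S)
      by (unfold r, rho; lra).
    assert (Hstab : forall t, 0 <= t <= T -> l2_le (seq_sub (Psi t) (Phi t)) (4 * dl)).
    { apply (duhamel_stable kappa gamma q0 K p F zeta (norminf zeta) (norm2 (bdiff zeta))
        (norm2 (mod_defect q0 zeta)) T Phi Psi Phi0 Psi0 dl (r + eta * S)); auto.
      - intros s Hs. apply l2_le_weaken with r; auto; lra.
      - intros s Hs. eapply l2_le_weaken; [apply Hrho|auto].
      (* The enlarged sum is (1 + eta) S, and (1 + eta)^(2p) = 2, so the constant is at most 6 * 2 /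
         16 = 3/4. *)
      - replace (r + eta * S + norminf zeta + q0) with (Rpower 2 (1 / (2 * p)) * S)
          by (unfold eta, S; ring).
        rewrite <- Rpower_mult_distr by (auto; apply exp_pos).
        rewrite Rpower_mult. replace (1 / (2 * p) * (2 * p)) with 1 by (field; lra).
        rewrite Rpower_1 by lra. lra. }
    apply Rbar_le_lt_trans with (Finite (4 * dl)); [|simpl; lra].
    apply normCT_le. intros t Ht. apply (l2_le_ell2 _ _ (Hstab t Ht)).
Qed.
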